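(* Let $A$ be the generator of the $m$-symmetric strongly continuous sub-Markovian semigroup $(P_t)_{t\ge0}$ on $L^2(m)$ of a symmetric Markov process, with spectral family $(E_\lambda)_{\lambda\ge0}$. Let $t>0$ and let $\phi:[0,\infty)\to[0,\infty)$ be a continuous function with $\liminf_{x\to\infty}\phi(x)>0$ and $\sup_{x\ge0}e^{-tx}\phi(x)<\infty$. Then for any $g\in L^2(m)$ and any $\gamma\in(0,1)$ there exists a unique solution $f\in L^2(m)$ to $$(1-\gamma)P_tf+\gamma\,\phi(-A)f=g .$$ Moreover, the solution is given by $$f=\int_0^\infty\frac{1}{\gamma\phi(\lambda)+(1-\gamma)e^{-\lambda t}}\,dE_\lambda g ,$$ and has the property that $$(1-\gamma)f=\operatorname*{arg\,min}_{h\in L^2(m)}\ \|P_th-g\|^2+\frac{\gamma}{1-\gamma}\,(P_t\phi(-A)h,h).$$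
   Context: Setting: $X$ is a Borel right Markov process whose state space $\mathbf E$ is a locally compact separable metric space with Borel $\sigma$-algebra $\mathscr E$; $m$ is a $\sigma$-finite measure on $\mathscr E$ with full support such that $(\mathbf E,\mathscr E,m)$ is a separable measure space, so $L^2(m):=L^2(\mathbf E,m)$ is a separable Hilbert space with inner product $(f,g)=\int_{\mathbf E} fg\,dm$ and norm $\|\cdot\|$. The transition semigroup of $X$ extends to a strongly continuous sub-Markovian semigroup $(P_t)_{t\ge0}$ on $L^2(m)$ that is symmetric: $(P_tf,g)=(f,P_tg)$ for all $f,g\in L^2(m)$. Its generator is $Af=\lim_{t\to0}(P_tf-f)/t$ (limit in $L^2(m)$, with domain $\mathscr D(A)$ where the limit exists). $-A$ is non-negative and self-adjoint, and $(E_\lambda)_{0\le\lambda<\infty}$ is its spectral family of projections, $-A=\int_0^\infty\lambda\,dE_\lambda$ (integrals over $[0,\infty)$, the mass $E_0$ at $0$ included). For continuous $\phi:[0,\infty)\to\mathbb R$, $\phi(-A)=\int_0^\infty\phi(\lambda)\,dE_\lambda$ with domain $\{f\in L^2(m):\int_0^\infty\phi(\lambda)^2\,d(E_\lambda f,f)<\infty\}$; in particular $P_t=\int_0^\infty e^{-\lambda t}dE_\lambda$. A solution of the equation is understood to belong to the domain of $\phi(-A)$. Here $P_t\phi(-A)$ denotes, on all of $L^2(m)$, the bounded operator $\int_0^\infty e^{-\lambda t}\phi(\lambda)\,dE_\lambda$. *)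

(* Defs.v *)
From HB Require Import structures.
From mathcomp Require Import all_boot all_order all_algebra.
From mathcomp Require Import all_classical all_reals all_analysis.
From mathcomp Require Import measurable_realfun.

Set Implicit Arguments.
Unset Strict Implicit.
Unset Printing Implicit Defensive.

Import Order.TTheory GRing.Theory Num.Theory.
Import numFieldNormedType.Exports.

Local Open Scope classical_set_scope.
Local Open Scope ring_scope.

(* The two structures are independent here; the theorem links them by asking
   that the measurable sets be the Borel sets. *)
#[short(type="metricMeasurableType")]
HB.structure Definition MetricMeasurable (R : numDomainType)
    (d : measure_display) := {T of Metric R T & Measurable d T}.

Definition separable_space (T : topologicalType) : Prop :=
  exists2 D : set T, countable D & dense D.

Section measures.
Context (R : realType) (d : measure_display).

Definition full_support (E : metricMeasurableType R d)
    (m : {measure set E -> \bar R}) : Prop :=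
  forall U : set E, open U -> U !=set0 -> (0 < m U)%E.

(* separability of the measure algebra, with metric m (A `+` B) *)
Definition separable_measure (T : measurableType d)
    (m : {measure set T -> \bar R}) : Prop :=
  exists2 A : (set T)^nat, (forall n, measurable (A n)) &
    forall B : set T, measurable B -> (m B < +oo)%E ->
    forall e : R, 0 < e -> exists n, (m (A n `+` B) < e%:E)%E.

End measures.

Section process.
Context (R : realType) (d dO : measure_display).
Context (E : metricMeasurableType R d) (Omega : measurableType dO).

(* [None] is the cemetery; a Borel function or set of E is extended to the
   compactification by 0, resp. by leaving the cemetery out. *)
Local Notation E_cem := (one_point_compactification E).

Variables (X : R -> Omega -> E_cem) (Pr : E_cem -> probability Omega R).

Definition hits (t : R) (B : set E) : set Omega :=
  X t @^-1` (@Some E @` B).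

Record right_continuous_filtration (F : R -> set (set Omega)) : Prop := {
  filtration_sigma : forall t, 0 <= t -> sigma_algebra setT (F t) ;
  filtration_measurable : forall t, 0 <= t -> F t `<=` measurable ;
  filtration_mono : forall s t, 0 <= s -> s <= t -> F s `<=` F t ;
  filtration_rc : forall t, 0 <= t ->
    \bigcap_(s in [set s | t < s]) F s `<=` F t
}.

Definition stopping_time (F : R -> set (set Omega)) (tau : Omega -> \bar R) :
    Prop :=
  (forall w, (0 <= tau w)%E) /\
  (forall t, 0 <= t -> F t [set w | (tau w <= t%:E)%E]).

Definition stopped_sigma_algebra (F : R -> set (set Omega))
    (tau : Omega -> \bar R) : set (set Omega) :=
  [set L | measurable L /\
    forall t, 0 <= t -> F t (L `&` [set w | (tau w <= t%:E)%E])].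

Definition strong_markov (F : R -> set (set Omega)) : Prop :=
  forall tau L s (B : set E) (x : E_cem),
    stopping_time F tau -> stopped_sigma_algebra F tau L ->
    0 <= s -> measurable B ->
    Pr x (L `&` [set w | (tau w < +oo)%E]
            `&` [set w | hits (fine (tau w) + s) B w]) =
    (\int[Pr x]_(w in L `&` [set w | (tau w < +oo)%E])
       Pr (X (fine (tau w)) w) (hits s B))%E.

Record borel_right_process : Prop := {
  process_measurable : forall (t : R) (B : set E), 0 <= t -> measurable B ->
    measurable (hits t B) ;
  process_borel : forall (t : R) (B : set E), 0 <= t -> measurable B ->
    measurable_fun [set: E] (fun x => Pr (Some x) (hits t B)) ;
  process_normal : forall x, Pr x (X 0 @^-1` [set x]) = 1%E ;
  process_absorbed : forall s t w, 0 <= s -> s <= t ->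
    X s w = None -> X t w = None ;
  process_rc : forall t w, 0 <= t -> X u w @[u --> t^'+] --> X t w ;
  process_shift : exists theta : R -> Omega -> Omega,
    forall s t w, 0 <= s -> 0 <= t -> X s (theta t w) = X (s + t) w ;
  process_strong_markov : exists F, [/\ right_continuous_filtration F,
    (forall (t : R) (B : set E), 0 <= t -> measurable B -> F t (hits t B)) &
    strong_markov F]
}.

Definition transition (t : R) (f : E -> R) (x : E) : R :=
  \int[Pr (Some x)]_w (if X t w is Some y then f y else 0).

End process.

(* Elements of L^2 are represented by functions, and equality in L^2 is
   equality almost everywhere. *)
Notation L2 m := (LfunType m (lee1n 2)).

Section L2.
Context (R : realType) (d : measure_display) (T : measurableType d).
Variable m : {measure set T -> \bar R}.
Implicit Types f g h : L2 m.

Definition eqL2 f g : Prop := f = g %[ae m].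

Definition dotL2 f g : R := \int[m]_x (f x * g x).

Definition normL2 f : R := fine ('N[m]_2%:E[EFin \o f])%E.

Record linearL2 (K : L2 m -> L2 m) : Prop := {
  linearL2_ae : forall f g, eqL2 f g -> eqL2 (K f) (K g) ;
  linearL2P : forall (a : R) f g, eqL2 (K (a *: f + g)) (a *: K f + K g)
}.

Definition unique_argminL2 (J : L2 m -> R) f : Prop :=
  (forall h, J f <= J h) /\ (forall h, J h <= J f -> eqL2 h f).

Record symmetric_submarkov_semigroup (P : R -> L2 m -> L2 m) : Prop := {
  semigroup_linear : forall t, 0 <= t -> linearL2 (P t) ;
  semigroup_contraction : forall t f, 0 <= t -> normL2 (P t f) <= normL2 f ;
  semigroup0 : forall f, eqL2 (P 0 f) f ;
  semigroupD : forall s t f, 0 <= s -> 0 <= t ->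
    eqL2 (P (s + t) f) (P s (P t f)) ;
  semigroup_continuous : forall f,
    normL2 (P t f - f) @[t --> (0 : R)^'+] --> (0 : R) ;
  semigroup_submarkov : forall t f, 0 <= t ->
    (\forall x \ae m, 0 <= f x <= 1) ->
    (\forall x \ae m, 0 <= P t f x <= 1) ;
  semigroup_symmetric : forall t f g, 0 <= t ->
    dotL2 (P t f) g = dotL2 f (P t g)
}.

(* graph of the generator A: [f] is in its domain and A f = h *)
Definition generator (P : R -> L2 m -> L2 m) f h : Prop :=
  normL2 (s^-1 *: (P s f - f) - h) @[s --> (0 : R)^'+] --> (0 : R).

(* A family indexed by [0, +oo[, extended by 0 to the negative reals so that
   the measures below have mass (E_0 f, f) at 0. *)
Record spectral_family := {
  spectral_proj :> R -> L2 m -> L2 m ;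
  spectral_linear : forall a, linearL2 (spectral_proj a) ;
  spectral_symmetric : forall a f g,
    dotL2 (spectral_proj a f) g = dotL2 f (spectral_proj a g) ;
  spectral_min : forall a b f,
    eqL2 (spectral_proj a (spectral_proj b f))
         (spectral_proj (Num.min a b) f) ;
  spectral_rc : forall a f,
    normL2 (spectral_proj b f - spectral_proj a f) @[b --> a^'+] --> (0 : R) ;
  spectral_cvg : forall f,
    normL2 (spectral_proj b f - f) @[b --> +oo] --> (0 : R) ;
  spectral_neg : forall a f, a < 0 -> eqL2 (spectral_proj a f) 0
}.

Lemma dotL2_integrable f g : m.-integrable setT (fun x => (f x * g x)%:E).
Proof. by apply/Lfun1_integrable/Lfun2_mul_Lfun1; exact: LfunP. Qed.

Lemma dotL2C f g : dotL2 f g = dotL2 g f.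
Proof. by apply: eq_Rintegral => x _; rewrite mulrC. Qed.

Lemma dotL2Bl f g h : dotL2 (f - g) h = dotL2 f h - dotL2 g h.
Proof.
rewrite /dotL2 -RintegralB//; try exact: dotL2_integrable.
by apply: eq_Rintegral => x _; rewrite -mulrBl.
Qed.

Lemma dotL2Br f g h : dotL2 h (f - g) = dotL2 h f - dotL2 h g.
Proof. by rewrite dotL2C dotL2Bl 2!(dotL2C h). Qed.

Lemma eq_dotL2l f g h : eqL2 f g -> dotL2 f h = dotL2 g h.
Proof.
move=> fg; rewrite /dotL2 /Rintegral; congr fine; apply: ae_eq_integral => //.
- exact/measurable_int/dotL2_integrable.
- exact/measurable_int/dotL2_integrable.
- by apply: filterS fg => x /(_ I) fg _; rewrite fg.
Qed.

Lemma normL2_sqr f : normL2 f ^+ 2 = dotL2 f f.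
Proof.
have fN : 'N[m]_2%:E[EFin \o f]%E \is a fin_num.
  by rewrite ge0_fin_numE ?Lnorm_ge0//; exact: Lfunction_finite.
apply: EFin_inj; rewrite /normL2 /dotL2 /Rintegral.
rewrite fineK; last by apply: integrable_fin_num => //; exact: dotL2_integrable.
rewrite -powR_mulrn ?fine_ge0 ?Lnorm_ge0// -poweR_EFin fineK// poweR_Lnorm//.
apply: eq_integral => x _ /=.
by rewrite powR_mulrn// real_normK ?num_real// expr2.
Qed.

Section spectral_measure.
Variable Sp : spectral_family.

Lemma spectral_dotB a b f : a <= b ->
  dotL2 (Sp b f) f - dotL2 (Sp a f) f = normL2 (Sp b f - Sp a f) ^+ 2.
Proof.
move=> ab; have SS c e : c <= e -> dotL2 (Sp c f) (Sp e f) = dotL2 (Sp c f) f.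
  move=> ce; rewrite -spectral_symmetric (eq_dotL2l f (spectral_min Sp e c f)).
  by rewrite min_r.
have Sid c : dotL2 (Sp c f) (Sp c f) = dotL2 (Sp c f) f by exact: SS.
rewrite normL2_sqr dotL2Bl !dotL2Br (dotL2C (Sp b f) (Sp a f)).
by rewrite !Sid SS// subrr subr0.
Qed.

Definition spectral_cdf f (a : R) : R := dotL2 (Sp a f) f.

Lemma spectral_cdf_nondecreasing f : nondecreasing (spectral_cdf f).
Proof. by move=> a b ab; rewrite -subr_ge0 spectral_dotB// sqr_ge0. Qed.

Lemma spectral_cdf_right_continuous f : right_continuous (spectral_cdf f).
Proof.
move=> a; apply/subr_cvg0.
have /(_ _) := cvgM (spectral_rc Sp a f) (spectral_rc Sp a f).
rewrite mulr0.
apply: cvg_trans; apply: near_eq_cvg; near=> b.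
by rewrite /= -expr2 -spectral_dotB.
Unshelve. all: by end_near. Qed.

HB.instance Definition _ f := isCumulative.Build R _ R (spectral_cdf f)
  (spectral_cdf_nondecreasing f) (@spectral_cdf_right_continuous f).

(* the measure d(E_a f, f) *)
Definition spectral_measure f := lebesgue_stieltjes_measure (spectral_cdf f).

(* the integral of phi against d(E_a f, g) on [0, c], by polarization *)
Definition spectral_form (phi : R -> R) (c : R) f g : R :=
  4^-1 * (\int[spectral_measure (f + g)]_(a in `[0, c]) phi a
        - \int[spectral_measure (f - g)]_(a in `[0, c]) phi a).

Definition spectral_dom (phi : R -> R) f : Prop :=
  (\int[spectral_measure f]_(a in `[0%R, +oo[) (phi a ^+ 2)%:E < +oo)%E.

(* h is the integral of phi dE f over [0, +oo[. For phi continuous on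
   [0, +oo[ both integrals in [spectral_form] are finite, which they need not
   be on [0, +oo[ itself when g is not in the domain. *)
Definition spectral_integral (phi : R -> R) f h : Prop :=
  spectral_dom phi f /\
  forall g, spectral_form phi n%:R f g @[n --> \oo] --> dotL2 h g.

End spectral_measure.

End L2.

(* The L^2 semigroup extends the transition semigroup, which acts on bounded
   Borel functions. *)
Definition extends_transition (R : realType) (d dO : measure_display)
    (E : metricMeasurableType R d) (Omega : measurableType dO)
    (X : R -> Omega -> one_point_compactification E)
    (Pr : one_point_compactification E -> probability Omega R)
    (m : {measure set E -> \bar R}) (P : R -> L2 m -> L2 m) : Prop :=
  forall (t : R) (f : L2 m), 0 <= t -> (exists M, forall x, `|f x| <= M) ->
    P t f = transition X Pr t f %[ae m].

(* (A f = h) iff (- A f = - h = the integral of a dE_a f), domains included *)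
Definition spectral_family_of_generator (R : realType) (d : measure_display)
    (T : measurableType d) (m : {measure set T -> \bar R})
    (P : R -> L2 m -> L2 m) (Sp : spectral_family m) : Prop :=
  forall f h, generator P f h <-> spectral_integral Sp (fun a => a) f (- h).

(* [f] is in the domain of phi(-A) and (1 - c) P_t f + c phi(-A) f = g *)
Definition solves (R : realType) (d : measure_display)
    (T : measurableType d) (m : {measure set T -> \bar R})
    (P : R -> L2 m -> L2 m) (Sp : spectral_family m)
    (t : R) (phi : R -> R) (c : R) (g f : L2 m) : Prop :=
  exists2 h, spectral_integral Sp phi f h &
    eqL2 ((1 - c) *: P t f + c *: h) g.

(* Main.v *)
(** The bounded functional calculus [psi |-> int psi dE] is built by hand: the
    Riemann-Stieltjes sums [sum_i psi(a_i) (E_{a_{i+1}} f - E_{a_i} f)] of two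
    functions on two grids have as inner product the integral of the product of
    the corresponding step functions against [d(E_a f, f)], so dominated
    convergence makes them Cauchy in L^2, and they are multiplicative in [psi]
    because the increments of [E] are orthogonal projections.

    [P_t = int e^{-ta} dE_a] follows on the spectral subspaces [a <= n], where
    [A] is bounded: there [P_h] and [int e^{-ha} dE_a] both agree with [1 + hA]
    up to [O(h^2)], and summing the errors over the [N] steps of size [t/N]
    leaves [O(1/N)].

    The solution is [f = int 1/D dE g] with [D = gamma phi + (1 - gamma) e^{-ta}],
    which is bounded below. Two solutions differ by [k] with
    [(1 - gamma) (P_t k, k) + gamma (phi(-A) k, k) = 0]; both terms are
    nonnegative and [(P_t k, k) = ||P_{t/2} k||^2], so [k = 0] as a symmetric
    strongly continuous semigroup is injective. The functional to be minimized
    is quadratic, its gradient vanishes at [(1 - gamma) f], and its second-order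
    part is at least [||P_t k||^2]. *)

Require Import Defs.
From mathcomp Require Import all_boot all_order all_algebra.
From mathcomp Require Import all_classical all_reals all_analysis.
From mathcomp Require Import measurable_realfun.
From mathcomp Require Import ring lra.

Set Implicit Arguments.
Unset Strict Implicit.
Unset Printing Implicit Defensive.

Import Order.TTheory GRing.Theory Num.Theory.
Import numFieldNormedType.Exports.

Local Open Scope classical_set_scope.
Local Open Scope ring_scope.

Lemma cvg_dist_le {R : realType} {I : Type} {F : set_system I} {FF : Filter F}
    (u v : I -> R) (l : R) :
  (\forall x \near F, `|u x - l| <= v x) -> v x @[x --> F] --> (0 : R) ->
  u x @[x --> F] --> l.
Proof.
move=> uv /cvgrPdist_le v0; apply/cvgrPdist_le => e e0.
apply: filterS2 uv (v0 _ e0) => x uv; rewrite distrC => vx.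
by rewrite distrC (le_trans uv)// (le_trans (ler_norm _))// -(subr0 (v x)).
Qed.

(** * The semi-inner product on L^2 *)

Section L2_algebra.
Context {R : realType} {d : measure_display} {T : measurableType d}.
Context {m : {measure set T -> \bar R}}.
Implicit Types f g h k : L2 m.

Lemma dotL2Dl f g h : dotL2 (f + g) h = dotL2 f h + dotL2 g h.
Proof.
rewrite /dotL2 -RintegralD//; try exact: dotL2_integrable.
by apply: eq_Rintegral => x _; rewrite -mulrDl.
Qed.

Lemma dotL2Dr f g h : dotL2 h (f + g) = dotL2 h f + dotL2 h g.
Proof. by rewrite dotL2C dotL2Dl 2!(dotL2C h). Qed.

Lemma dotL2Zl a f h : dotL2 (a *: f) h = a * dotL2 f h.
Proof.
rewrite /dotL2 -RintegralZl//; last exact: dotL2_integrable.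
by apply: eq_Rintegral => x _; rewrite mulrA.
Qed.

Lemma dotL2Zr a f h : dotL2 h (a *: f) = a * dotL2 h f.
Proof. by rewrite dotL2C dotL2Zl dotL2C. Qed.

Lemma dotL2_lin2 a b f g h :
  dotL2 (a *: f + b *: g) h = a * dotL2 f h + b * dotL2 g h.
Proof. by rewrite dotL2Dl !dotL2Zl. Qed.

Lemma dotL20l h : dotL2 0 h = 0.
Proof. by rewrite -(scale0r 0) dotL2Zl mul0r. Qed.

Lemma dotL2Nl f h : dotL2 (- f) h = - dotL2 f h.
Proof. by rewrite -scaleN1r dotL2Zl mulN1r. Qed.

Lemma dotL2_suml I (r : seq I) (F : I -> L2 m) h :
  dotL2 (\sum_(i <- r) F i) h = \sum_(i <- r) dotL2 (F i) h.
Proof.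
elim: r => [|i r IH]; first by rewrite !big_nil dotL20l.
by rewrite !big_cons dotL2Dl IH.
Qed.

Lemma normL2_ge0 f : 0 <= normL2 f.
Proof. by rewrite /normL2 fine_ge0// Lnorm_ge0. Qed.

Lemma dotL2_ge0 f : 0 <= dotL2 f f.
Proof. by rewrite -normL2_sqr sqr_ge0. Qed.

Lemma normL2_le f (a : R) : 0 <= a -> dotL2 f f <= a ^+ 2 -> normL2 f <= a.
Proof.
by move=> a0; rewrite -normL2_sqr ler_pXn2r// nnegrE normL2_ge0.
Qed.

Lemma cauchy_schwarzL2 f g : `|dotL2 f g| <= normL2 f * normL2 g.
Proof.
(* The square of |g|^2 f - (f, g) g is |g|^2 (|f|^2 |g|^2 - (f, g)^2); dividing by |g|^2 requires
   the case |g| = 0 to be treated apart. *)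
have := dotL2_ge0 (normL2 g ^+ 2 *: f - dotL2 f g *: g).
rewrite dotL2Bl !dotL2Br !dotL2Zl !dotL2Zr -!normL2_sqr (dotL2C g f).
set x := dotL2 f g; have := normL2_ge0 f; have := normL2_ge0 g.
case: (eqVneq (normL2 g) 0) => [g0 _ f0|g0 g0' f0 H].
  rewrite g0 mulr0 => _.
  have {}g0 : eqL2 g 0 by exact: fine_Lnormr_eq0.
  by rewrite /x dotL2C (eq_dotL2l _ g0) dotL20l normr0.
rewrite -(@ler_pXn2r _ 2)// ?nnegrE ?mulr_ge0// real_normK ?num_real//.
rewrite exprMn -subr_ge0 -(@pmulr_rge0 _ (normL2 g ^+ 2)); last first.
  by rewrite exprn_gt0// lt_def g0.
apply: (le_trans H); rewrite le_eqVlt; apply/orP; left; apply/eqP; ring.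
Qed.

Lemma normL2D f g : normL2 (f + g) <= normL2 f + normL2 g.
Proof. exact: ler_LnormD. Qed.

Lemma normL2Z a f : normL2 (a *: f) = `|a| * normL2 f.
Proof.
apply/eqP; rewrite -(@eqrXn2 _ 2)// ?mulr_ge0 ?normL2_ge0//.
rewrite exprMn !normL2_sqr dotL2Zl dotL2Zr real_normK ?num_real//.
by apply/eqP; ring.
Qed.

Lemma normL2N f : normL2 (- f) = normL2 f.
Proof. by rewrite -scaleN1r normL2Z normrN1 mul1r. Qed.

Lemma normL2B f g : normL2 (f - g) = normL2 (g - f).
Proof. by rewrite -normL2N opprB. Qed.

Lemma normL2_trans g f h : normL2 (f - h) <= normL2 (f - g) + normL2 (g - h).
Proof. by rewrite (le_trans _ (normL2D _ _))// addrA subrK. Qed.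

Lemma normL2_sum I (r : seq I) (F : I -> L2 m) :
  normL2 (\sum_(i <- r) F i) <= \sum_(i <- r) normL2 (F i).
Proof.
elim: r => [|i r IH].
  by rewrite !big_nil -(scale0r 0) normL2Z normr0 mul0r.
by rewrite !big_cons (le_trans (normL2D _ _))// lerD2l.
Qed.

(** Almost-everywhere equality of representatives does not support rewriting; testing against every
    [k] turns it into equations between reals. The converse uses [k = f - g]. *)
Lemma eqL2_dotP f g : eqL2 f g <-> forall k, dotL2 f k = dotL2 g k.
Proof.
split=> [fg k|fg]; first exact: eq_dotL2l.
have : normL2 (f - g) = 0.
  by apply/eqP; rewrite -sqrf_eq0 normL2_sqr dotL2Bl fg subrr.
move/fine_Lnormr_eq0 => /=; rewrite /eqL2; apply: filterS => x /(_ I) /= h _.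
by apply/subr0_eq.
Qed.

Lemma eqL2_normP f g : eqL2 f g <-> normL2 (f - g) = 0.
Proof.
split=> [/eqL2_dotP fg|fg].
  by apply/eqP; rewrite -sqrf_eq0 normL2_sqr dotL2Bl fg subrr.
apply/eqL2_dotP => k; apply/eqP; rewrite -subr_eq0 -dotL2Bl -normr_le0.
by rewrite (le_trans (cauchy_schwarzL2 _ _))// fg mul0r.
Qed.

Lemma eqL2_refl f : eqL2 f f. Proof. by apply/eqL2_dotP. Qed.

Lemma eqL2_sym f g : eqL2 f g -> eqL2 g f.
Proof. by move/eqL2_dotP => h; apply/eqL2_dotP => k. Qed.

Lemma eqL2_trans g f h : eqL2 f g -> eqL2 g h -> eqL2 f h.
Proof.
by move=> /eqL2_dotP h1 /eqL2_dotP h2; apply/eqL2_dotP => k; rewrite h1.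
Qed.

Lemma eqL2_norm f g : eqL2 f g -> normL2 f = normL2 g.
Proof.
move=> /eqL2_dotP h; apply/eqP; rewrite -(@eqrXn2 _ 2)// ?normL2_ge0//.
by rewrite !normL2_sqr h dotL2C h.
Qed.

(** Linearity of [A] is not assumed: symmetry moves [A] to the other factor, where the inner product
    itself is additive. Results on quadratic forms thus extend to bilinear ones. *)
Lemma sym_polarization (A : L2 m -> L2 m) f g :
  (forall h k, dotL2 (A h) k = dotL2 h (A k)) ->
  dotL2 (A f) g = 4^-1 * (dotL2 (A (f + g)) (f + g) - dotL2 (A (f - g)) (f - g)).
Proof.
move=> sA.
have e1 h : dotL2 (A (f + g)) h = dotL2 (A f) h + dotL2 (A g) h.
  by rewrite sA dotL2Dl -!sA.
have e2 h : dotL2 (A (f - g)) h = dotL2 (A f) h - dotL2 (A g) h.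
  by rewrite sA dotL2Bl -!sA.
have e3 : dotL2 (A g) f = dotL2 (A f) g by rewrite sA dotL2C.
rewrite (e1 (f + g)) (e2 (f - g)) (dotL2Dr f g (A f)) (dotL2Dr f g (A g)).
rewrite (dotL2Br f g (A f)) (dotL2Br f g (A g)) e3.
by move: (dotL2 (A f) f) (dotL2 (A f) g) (dotL2 (A g) g) => a b c; lra.
Qed.

Definition cvgL2 (u : nat -> L2 m) f := normL2 (u n - f) @[n --> \oo] --> (0:R).

Lemma cvgL2_dot u f k : cvgL2 u f -> dotL2 (u n) k @[n --> \oo] --> dotL2 f k.
Proof.
move=> uf; apply: (@cvg_dist_le _ _ _ _ _ (fun n => normL2 (u n - f) * normL2 k)).
  by apply: nearW => n; rewrite -dotL2Bl cauchy_schwarzL2.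
by rewrite -(mul0r (normL2 k)); apply: cvgMl.
Qed.

Lemma cvgL2_dot2 u v f g : cvgL2 u f -> cvgL2 v g ->
  dotL2 (u n) (v n) @[n --> \oo] --> dotL2 f g.
Proof.
move=> uf vg; apply: (@cvg_dist_le _ _ _ _ _ (fun n =>
  normL2 (u n - f) * normL2 (v n - g) + normL2 (u n - f) * normL2 g +
  normL2 f * normL2 (v n - g))).
  apply: nearW => n.
  have -> : dotL2 (u n) (v n) - dotL2 f g = dotL2 (u n - f) (v n - g) +
      dotL2 (u n - f) g + dotL2 f (v n - g).
    by rewrite !dotL2Bl !dotL2Br; ring.
  apply: (le_trans (ler_normD _ _)); apply: lerD; last exact: cauchy_schwarzL2.
  by apply: (le_trans (ler_normD _ _)); apply: lerD; exact: cauchy_schwarzL2.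
rewrite [X in _ --> X](_ : 0 = 0 * 0 + 0 * normL2 g + normL2 f * 0); last by ring.
apply: cvgD; [apply: cvgD|]; apply: cvgM => //; exact: cvg_cst.
Qed.

End L2_algebra.

(** * Completeness of L^2 *)

Lemma cvg_of_geometric_steps {R : realType} (v : nat -> R) (C : R) :
  (forall i, `|v i.+1 - v i| <= C * 2^-1 ^+ i) -> cvgn v.
Proof.
move=> vC.
have C0 : 0 <= C by have := vC 0%N; rewrite expr0 mulr1; exact: le_trans.
have cs : cvgn (series (fun i => v i.+1 - v i)).
  apply: normed_cvg; apply: (@series_le_cvg _ _ (geometric C 2^-1)).
  - by move=> n; exact: normr_ge0.
  - by move=> n; apply: geometric_ge0; rewrite ?invr_ge0.
  - exact: vC.
  - by apply: is_cvg_geometric_series; rewrite ger0_norm ?invr_ge0// invf_lt1// ltr1n.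
have vE : v = (fun n => v 0%N + series (fun i => v i.+1 - v i) n).
  apply/funext => n; rewrite /series /= telescope_sumr// addrC subrK//.
by rewrite vE; apply: is_cvgD => //; exact: is_cvg_cst.
Qed.

Section completeness.
Context {R : realType} {d : measure_display} {T : measurableType d}.
Context {m : {measure set T -> \bar R}}.

Lemma EFin_dotL2 (f g : L2 m) :
  (dotL2 f g)%:E = (\int[m]_x (f x * g x)%:E)%E.
Proof.
rewrite /dotL2 /Rintegral fineK//; apply: integrable_fin_num => //.
exact: dotL2_integrable.
Qed.

Lemma Lfun2_of_sqr (g : T -> R) : measurable_fun setT g ->
  (\int[m]_x (g x ^+ 2)%:E < +oo)%E -> g \in Lfun m 2%:E.
Proof.
move=> mg ig; rewrite inE/=; apply/andP; split; rewrite inE//=.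
rewrite /finite_norm unlock poweR_lty//.
under eq_integral => x _ do rewrite /= powR_mulrn// real_normK ?num_real//.
exact: ig.
Qed.

(* The weights 4^i keep sum_i 4^i |v_{i+1} - v_i|^2 integrable, hence a.e. finite,
   which bounds |v_{i+1} - v_i| by a geometric sequence a.e. *)
Lemma rapid_ae_cvg (v : nat -> L2 m) :
  (forall i, normL2 (v i.+1 - v i) ^+ 2 <= 8^-1 ^+ i) ->
  {ae m, forall x, cvgn (fun i => v i x)}.
Proof.
move=> v8; pose D i x : \bar R := (4 ^+ i * (v i.+1 x - v i x) ^+ 2)%:E.
have mD i : measurable_fun setT (D i).
  apply/measurable_EFinP; apply: measurable_funM => //.
  by apply: measurable_funX; exact: measurable_funB.
have D0 i x : setT x -> (0 <= D i x)%E.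
  by rewrite lee_fin mulr_ge0 ?sqr_ge0 ?exprn_ge0.
have iS : (\int[m]_x \sum_(i <oo) D i x < +oo)%E.
  rewrite integral_nneseries//.
  apply: (@le_lt_trans _ _ (\sum_(i <oo) (2^-1 ^+ i)%:E)%E).
    apply: lee_nneseries => [i _ _|i _]; first by apply: integral_ge0 => x; exact: D0.
    have -> : (\int[m]_x D i x =
        (4 ^+ i * dotL2 (v i.+1 - v i) (v i.+1 - v i))%:E)%E.
      rewrite -dotL2Zl EFin_dotL2; apply: eq_integral => x _.
      by rewrite /D /= expr2 -mulrA.
    rewrite lee_fin -normL2_sqr.
    apply: (@le_trans _ _ (4 ^+ i * 8^-1 ^+ i)).
      by rewrite ler_pM2l// exprn_gt0.
    by rewrite -exprMn (_ : 4 * 8^-1 = 2^-1 :> R)//; lra.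
  have H : series (geometric 1 2^-1 : R^nat) @ \oo --> (1 * (1 - 2^-1)^-1 : R).
    by apply: cvg_geometric_series; rewrite ger0_norm ?invr_ge0// invf_lt1// ltr1n.
  have : (series (geometric 1 2^-1 : R^nat) n)%:E @[n --> \oo] -->
    (1 * (1 - 2^-1)^-1)%:E by apply: cvg_EFin H; exact: nearW.
  under eq_fun => n do rewrite /series/= -sumEFin.
  under eq_fun => n do under eq_bigr do rewrite mul1r.
  by move/cvg_lim => ->//; rewrite ltry.
have /integrable_ae : m.-integrable setT (fun x => \sum_(i <oo) D i x)%E.
  apply/integrableP; split; first by apply: ge0_emeasurable_sum => // k x _ _; exact: D0.
  rewrite (eq_integral (fun x => \sum_(i <oo) D i x)%E)// => x _.
  by rewrite gee0_abs// nneseries_ge0// => k _ _; exact: D0.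
move=> /(_ measurableT); apply: filterS => x /(_ I).
set S := (\sum_(i <oo) D i x)%E => Sfin.
apply: (@cvg_of_geometric_steps _ _ (Num.sqrt (fine S))) => i.
have DS : (D i x <= S)%E.
  apply: (le_trans _ (nneseries_lim_ge i.+1 _)) => [|j _ _]; last exact: D0.
  by rewrite big_nat_recr//= leeDr// sume_ge0// => j _; exact: D0.
have {}DS : 4 ^+ i * (v i.+1 x - v i x) ^+ 2 <= fine S.
  by rewrite -lee_fin fineK.
rewrite -sqrtr_sqr -[X in _ * X]ger0_norm ?exprn_ge0 ?invr_ge0//.
rewrite -sqrtr_sqr -sqrtrM; last by rewrite (le_trans _ DS)// mulr_ge0 ?sqr_ge0 ?exprn_ge0.
have E4 : 2^-1 ^+ 2 = 4^-1 :> R by rewrite expr2; lra.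
apply: ler_wsqrtr; rewrite -exprM mulnC exprM E4 exprVn.
by rewrite ler_pdivlMr ?exprn_gt0// mulrC.
Qed.

(** The conclusion is phrased with an arbitrary bound [e], so that any Cauchy estimate along the
    sequence passes to the limit [w], by Fatou's lemma. *)
Lemma rapid_cvgL2 (v : nat -> L2 m) :
  (forall i, normL2 (v i.+1 - v i) ^+ 2 <= 8^-1 ^+ i) ->
  exists w : L2 m, forall (e : R) n, 0 <= e ->
    (forall p, (n <= p)%N -> normL2 (v n - v p) <= e) -> normL2 (v n - w) <= e.
Proof.
move=> v8; have [N [mN N0 vN]] := rapid_ae_cvg v8.
(* Zeroing on the null set [N] makes the sequence converge at every point, so that its limit is
   measurable. *)
pose V i x : R := v i x * \1_(~` N) x.
have mV i : measurable_fun setT (V i).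
  apply: measurable_funM => //; apply: measurable_indic; exact: measurableC.
have cV x : cvgn (V ^~ x).
  have [xN|xN] := pselect (N x).
    suff -> : V ^~ x = (fun=> 0) by exact: is_cvg_cst.
    by apply/funext => i; rewrite /V indicE memNset ?mulr0//; exact.
  rewrite /V; under eq_fun do rewrite indicE mem_set// mulr1.
  by apply: contrapT => h; apply: xN; apply: vN.
pose w x := lim (V ^~ x @ \oo).
have mw : measurable_fun setT w by apply: (measurable_fun_cvg mV) => x _; exact: cV.
have VE p x : ~ N x -> V p x = v p x.
  by move=> Nx; rewrite /V indicE mem_set// mulr1.
(* Fatou's lemma for |v_n - V_p|^2 as p tends to infinity. The infimum over p >= q is bounded by its
   member [maxn n q], which also lies in the range of the hypothesis. *)
have key (e : R) n : 0 <= e -> (forall p, (n <= p)%N -> normL2 (v n - v p) <= e) ->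
    (\int[m]_x ((v n x - w x) ^+ 2)%:E <= (e ^+ 2)%:E)%E.
  move=> e0 ve.
  have mvp p : measurable_fun setT (fun x => ((v n x - V p x) ^+ 2)%:E).
    by apply/measurable_EFinP; apply: measurable_funX; exact: measurable_funB.
  have -> : (\int[m]_x ((v n x - w x) ^+ 2)%:E =
      \int[m]_x limn_einf (fun p => ((v n x - V p x) ^+ 2)%:E))%E.
    apply: eq_integral => x _; apply/esym.
    suff /cvg_limn_einf_sup[] : ((v n x - V p x) ^+ 2)%:E @[p --> \oo] -->
      ((v n x - w x) ^+ 2)%:E by [].
    apply: cvg_EFin; first exact: nearW.
    rewrite expr2; under eq_fun do rewrite expr2.
    by apply: cvgM; apply: cvgB; try exact: cvg_cst; exact: cV.
  apply: (le_trans (fatou m measurableT mvp _)).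
    by move=> p x _; rewrite lee_fin sqr_ge0.
  rewrite limn_einf_lim; apply: lime_le.
    exact: is_cvg_einfs.
  near=> q.
  apply: (@le_trans _ _ (\int[m]_x ((v n x - V (maxn n q) x) ^+ 2)%:E)%E).
    by apply: ereal_inf_lbound; exists (maxn n q) => //=; rewrite leq_maxr.
  have -> : (\int[m]_x ((v n x - V (maxn n q) x) ^+ 2)%:E =
     (normL2 (v n - v (maxn n q)) ^+ 2)%:E)%E.
    rewrite normL2_sqr EFin_dotL2; apply: ae_eq_integral => //.
      apply/measurable_EFinP; apply: measurable_funM => //; exact: measurable_funB.
    exists N; split => // x /= /not_implyP [_ h]; apply: contrapT => Nx; apply: h.
    by rewrite VE// expr2.
  by rewrite lee_fin ler_pXn2r ?nnegrE ?normL2_ge0 ?ve// leq_maxl.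
(* Each step has norm at most 8^(-i/2) <= 2^-i, so the sums stay below 2; any finite bound would
   serve. *)
have v0 p : normL2 (v 0%N - v p) <= 4.
  have -> : v 0%N - v p = - \sum_(0 <= i < p) (v i.+1 - v i).
    by rewrite telescope_sumr// opprB.
  rewrite normL2N (le_trans (normL2_sum _ _))//.
  apply: (@le_trans _ _ (\sum_(0 <= i < p) 2^-1 ^+ i)).
    apply: ler_sum => i _; rewrite -(@ler_pXn2r _ 2) ?nnegrE ?normL2_ge0 ?exprn_ge0 ?invr_ge0//.
    apply: (le_trans (v8 i)); rewrite -exprM mulnC exprM.
    by apply: lerXn2r; rewrite ?nnegrE ?exprn_ge0 ?invr_ge0//; lra.
  have -> : \sum_(0 <= i < p) 2^-1 ^+ i = 2 - 2 * 2^-1 ^+ p :> R.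
    elim: p => [|p IH]; first by rewrite big_nil expr0; lra.
    by rewrite big_nat_recr//= IH exprS; lra.
  have : 0 <= 2^-1 ^+ p :> R by rewrite exprn_ge0// invr_ge0.
  lra.
(* [key] controls differences only, so v_0 - w is the function shown to be square integrable, and
   the limit is recovered as v_0 - (v_0 - w). *)
have L : (fun x => v 0%N x - w x) \in Lfun m 2%:E.
  apply: Lfun2_of_sqr; first exact: measurable_funB.
  by apply: (le_lt_trans (key 4 0%N _ _)) => //; rewrite ltry.
pose G : L2 m := Lfun_Sub (lee1n 2) L.
exists (v 0%N - G) => e n e0 ve.
apply: normL2_le => //; rewrite -lee_fin EFin_dotL2; apply: le_trans (key e n e0 ve).
rewrite le_eqVlt; apply/orP; left; apply/eqP; apply: eq_integral => x _.
have -> : (v n - (v 0%N - G)) x = v n x - w x.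
  by transitivity (v n x - (v 0%N x - (v 0%N x - w x))); [|ring].
by rewrite expr2.
Unshelve. all: by end_near. Qed.

Lemma L2_complete (u : nat -> L2 m) :
  (forall e : R, 0 < e -> exists N : nat, forall n p, (N <= n)%N -> (N <= p)%N ->
     normL2 (u n - u p) <= e) ->
  exists w, cvgL2 u w.
Proof.
move=> uC.
have /choice[N uN] : forall i : nat, exists N : nat, forall n p,
    (N <= n)%N -> (N <= p)%N -> normL2 (u n - u p) <= 8^-1 ^+ i.
  by move=> i; apply: uC; rewrite exprn_gt0// invr_gt0.
(* Summing the thresholds, instead of using [N i] itself, makes the subsequence nondecreasing while
   keeping [k i] above [N i]. *)
pose k i := (\sum_(j < i.+1) N j)%N.
have kN i : (N i <= k i)%N by rewrite /k big_ord_recr leq_addl.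
have kS i : (k i <= k i.+1)%N by rewrite /k [leqRHS]big_ord_recr leq_addr.
have kmono i j : (i <= j)%N -> (k i <= k j)%N.
  by apply: (@homo_leq _ k leq) => //; exact: leq_trans.
have [i|w wP] := @rapid_cvgL2 (u \o k).
  have le1 : 8^-1 ^+ i <= 1 :> R.
    by rewrite exprn_ile1// ?invr_ge0// invf_le1// ler1n.
  apply: (@le_trans _ _ ((8^-1 ^+ i) ^+ 2)).
    rewrite ler_pXn2r ?nnegrE ?normL2_ge0 ?exprn_ge0 ?invr_ge0//.
    by apply: uN => //; rewrite (leq_trans (kN i)).
  by rewrite expr2 ler_piMr// exprn_ge0// invr_ge0.
exists w; apply/cvgrPdist_le => e e0.
have e20 : 0 < e / 2 by rewrite divr_gt0.
have [i ie] : exists i : nat, 8^-1 ^+ i <= e / 2.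
  have : (fun i => 8^-1 ^+ i : R) @ \oo --> (0:R).
    by apply: cvg_expr; rewrite ger0_norm ?invr_ge0// invf_lt1// ltr1n.
  move=> /cvgrPdist_le /(_ (e / 2) e20)[i _ /(_ i (leqnn _))].
  by rewrite sub0r normrN ger0_norm ?exprn_ge0 ?invr_ge0//; exists i.
have h1 : normL2 ((u \o k) i - w) <= e / 2.
  apply: wP => [|p ip]; first exact: ltW.
  by apply: (le_trans _ ie); apply: uN => //; rewrite (leq_trans (kN i))// kmono.
exists (k i) => // n /= kin.
rewrite sub0r normrN ger0_norm ?normL2_ge0// (splitr e).
rewrite (le_trans (normL2_trans (u (k i)) _ _))// lerD//.
by apply: (le_trans _ ie); apply: uN => //; rewrite (leq_trans (kN i)).
Qed.

End completeness.

(** * Bounded functional calculus of a spectral family *)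

Section bounded_Rintegral.
Context {R : realType} {d : measure_display} {T : measurableType d}.
Variables (mu : {measure set T -> \bar R}) (mu_fin : (mu setT < +oo)%E).
Implicit Types (f g : T -> R) (M : R).

Lemma bounded_integrable f M : measurable_fun setT f ->
  (forall x, `|f x| <= M) -> mu.-integrable setT (EFin \o f).
Proof.
move=> mf fM; apply: measurable_bounded_integrable => //.
exists M; split; first exact: num_real.
by move=> x Mx y _ /=; rewrite (le_trans (fM y))// ltW.
Qed.

Lemma bounded_cvg_Rintegral (f_ : nat -> T -> R) f M :
  (forall n, measurable_fun setT (f_ n)) ->
  (forall n x, `|f_ n x| <= M) -> (forall x, f_ n x @[n --> \oo] --> f x) ->
  \int[mu]_x f_ n x @[n --> \oo] --> \int[mu]_x f x.
Proof.
move=> mf fM ff.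
have mF : measurable_fun setT f by apply: (measurable_fun_cvg mf) => x _.
have := @dominated_convergence _ _ _ mu _ measurableT (fun n x => (f_ n x)%:E)
  (EFin \o f) (fun=> M%:E).
case.
- by move=> n; exact/measurable_EFinP.
- exact/measurable_EFinP.
- by apply: aeW => x _; apply: cvg_EFin; [exact: nearW | exact: ff].
- have M0 : 0 <= `|M| by []; apply: (@bounded_integrable (fun=> M) `|M|) => //.
- by apply: aeW => x n _; rewrite lee_fin fM.
move=> If _ H; apply: fine_cvg.
by rewrite fineK //; exact: integrable_fin_num.
Qed.

Lemma bounded_Rintegral_sum (I : finType) (c : I -> R) (g : I -> T -> R) M :
  (forall i, measurable_fun setT (g i)) -> (forall i x, `|g i x| <= M) ->
  \int[mu]_x (\sum_i c i * g i x) = \sum_i c i * \int[mu]_x g i x.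
Proof.
move=> mg gM.
have ig i : mu.-integrable setT (EFin \o (fun x => c i * g i x)).
  apply: (@bounded_integrable _ (`|c i| * M)); first exact: measurable_funM.
  by move=> x; rewrite normrM ler_wpM2l.
rewrite {1}/Rintegral.
under eq_integral do rewrite -sumEFin.
rewrite integral_sum//.
have E i : (\int[mu]_x (c i * g i x)%:E = (c i * \int[mu]_x g i x)%:E)%E.
  rewrite -RintegralZl//; last exact: (bounded_integrable (mg i) (gM i)).
  by rewrite /Rintegral fineK//; apply: integrable_fin_num => //; exact: ig.
by under eq_bigr do rewrite E; rewrite sumEFin.
Qed.

End bounded_Rintegral.

(** * Riemann-Stieltjes sums along a spectral family *)

Section spectral_steps.
Context {R : realType} {d : measure_display} {T : measurableType d}.
Context {m : {measure set T -> \bar R}} (Sp : spectral_family m).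
Implicit Types (f g k : L2 m) (psi chi : R -> R).

Lemma dot_spectral_min a b f g :
  dotL2 (Sp a f) (Sp b g) = dotL2 (Sp (Num.min a b) f) g.
Proof.
by rewrite -spectral_symmetric (eq_dotL2l _ (spectral_min Sp b a f)) minC.
Qed.

Lemma spectral_measure_oc f a b : a <= b ->
  spectral_measure Sp f `]a, b]%classic =
  (spectral_cdf Sp f b - spectral_cdf Sp f a)%:E.
Proof.
move=> ab; rewrite /spectral_measure /lebesgue_stieltjes_measure.
rewrite /measure_extension measurable_mu_extE/=; last exact: is_ocitv.
by rewrite wlength_itv_bnd.
Qed.

Lemma spectral_cdf_ge0 f a : 0 <= spectral_cdf Sp f a.
Proof.
by rewrite /spectral_cdf -[a]minxx -dot_spectral_min dotL2_ge0.
Qed.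

Lemma spectral_cdf_le f a : spectral_cdf Sp f a <= dotL2 f f.
Proof.
have := dotL2_ge0 (f - Sp a f).
rewrite dotL2Bl !dotL2Br dot_spectral_min minxx (dotL2C f).
by rewrite /spectral_cdf; lra.
Qed.

Lemma spectral_measure_setT f :
  (spectral_measure Sp f setT <= (dotL2 f f)%:E)%E.
Proof.
have cv : spectral_measure Sp f `](- n%:R), n%:R]%classic @[n --> \oo] -->
    spectral_measure Sp f (\bigcup_n `](- n%:R), n%:R]%classic).
  apply: nondecreasing_cvg_mu => //; first exact: bigcup_measurable.
  by move=> *; apply/subsetPset/subset_itv; rewrite leBSide/= ?lerN2 ler_nat.
have <- : \bigcup_n `](- n%:R), n%:R]%classic = [set: R].
  apply/seteqP; split => // x _; exists (Num.truncn `|x|).+1 => //=.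
  rewrite in_itv/=; have := truncnS_gt `|x|; rewrite ltr_norml => /andP[-> /ltW].
  by [].
rewrite -(cvg_lim _ cv)//; apply: lime_le; first by apply/cvg_ex; eexists; exact: cv.
apply: nearW => n; rewrite spectral_measure_oc ?ge0_cp//.
rewrite lee_fin (le_trans _ (spectral_cdf_le f n%:R))//.
by rewrite lerBlDr lerDl spectral_cdf_ge0.
Qed.

Lemma spectral_measure_fin f : (spectral_measure Sp f setT < +oo)%E.
Proof. by rewrite (le_lt_trans (spectral_measure_setT f))// ltry. Qed.

(** The N-th grid starts at -N and has 2N(N+1) cells of length 1/(N+1), filling ]-N, N]: the range
    grows and the mesh shrinks with a single index. *)
Definition gridpt (N i : nat) : R := i%:R / N.+1%:R - N%:R.

Definition gridsize (N : nat) : nat := (N.*2 * N.+1)%N.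

Definition grid_cell (N i : nat) : set R :=
  `]gridpt N i, gridpt N i.+1]%classic.

Definition spectral_inc (a b : R) f := Sp b f - Sp a f.

Definition stepop (N : nat) psi f : L2 m :=
  \sum_(i < gridsize N) psi (gridpt N i) *:
     spectral_inc (gridpt N i) (gridpt N i.+1) f.

Definition stepfun (N : nat) psi (x : R) : R :=
  \sum_(i < gridsize N) psi (gridpt N i) * \1_(grid_cell N i) x.

Lemma gridpt_le N i j : (i <= j)%N -> gridpt N i <= gridpt N j.
Proof. by move=> ij; rewrite lerB// ler_pM2r ?invr_gt0 ?ltr0Sn// ler_nat. Qed.

(** E_b - E_a projects onto the spectral values in ]a, b], so a product of two increments is the
    increment over the intersection of the intervals. *)
Lemma dot_spectral_inc a b c e f g : a <= b -> c <= e ->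
  dotL2 (spectral_inc a b f) (spectral_inc c e g) =
  if Num.max a c <= Num.min b e
  then dotL2 (spectral_inc (Num.max a c) (Num.min b e) f) g else 0.
Proof.
move=> ab ce; rewrite /spectral_inc !dotL2Bl !dotL2Br !dot_spectral_min.
case: ifPn => [|].
  rewrite ge_max !le_min => /andP[/andP[_ ae] /andP[cb _]].
  rewrite (min_r cb) (min_l ae).
  by case: (leP a c) => _; ring.
rewrite -ltNge lt_max !gt_min !(ltNge _ a) ab/= !(ltNge _ c) ce/= orbF -!ltNge.
move=> /orP[ea|bc].
  have eb := lt_le_trans ea ab; have ca := le_lt_trans ce ea.
  by rewrite (min_r (ltW eb)) (min_r (ltW ea)) (min_r (ltW ca))
    (min_r (ltW (lt_le_trans ca ab))); ring.
have be := lt_le_trans bc ce; have ac := le_lt_trans ab bc.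
by rewrite (min_l (ltW be)) (min_l (ltW bc)) (min_l (ltW ac))
  (min_l (ltW (lt_le_trans ac ce))); ring.
Qed.

Lemma spectral_inc_sym a b f g :
  dotL2 (spectral_inc a b f) g = dotL2 f (spectral_inc a b g).
Proof. by rewrite dotL2Bl dotL2Br !(spectral_symmetric Sp _ f). Qed.

Lemma dot_stepop N psi f g : dotL2 (stepop N psi f) g =
  \sum_(i < gridsize N) psi (gridpt N i) *
     dotL2 (spectral_inc (gridpt N i) (gridpt N i.+1) f) g.
Proof. by rewrite dotL2_suml; apply: eq_bigr => i _; rewrite dotL2Zl. Qed.

Lemma stepop_sym N psi f g : dotL2 (stepop N psi f) g = dotL2 f (stepop N psi g).
Proof.
rewrite (dotL2C f) !dot_stepop; apply: eq_bigr => i _.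
by rewrite spectral_inc_sym dotL2C.
Qed.

(** The cells of one grid are disjoint, so the double sum reduces to its diagonal, where each
    increment is idempotent. *)
Lemma stepop_mul N psi chi f g :
  dotL2 (stepop N psi f) (stepop N chi g) =
  dotL2 (stepop N (psi \* chi) f) g.
Proof.
rewrite !dot_stepop; apply: eq_bigr => i _; rewrite -mulrA; congr (_ * _).
rewrite dotL2C dot_stepop (bigD1 i)//= big1 ?addr0 => [|j ji].
  by rewrite dotL2C dot_spectral_inc ?gridpt_le// maxxx minxx gridpt_le.
rewrite dot_spectral_inc ?gridpt_le//; case: ifP; rewrite ?mulr0// => H.
(* If distinct cells pass the test of [dot_spectral_inc], their intersection is degenerate: its end
   points coincide and the increment over it is zero. *)
suff -> : Num.max (gridpt N j) (gridpt N i) = Num.min (gridpt N j.+1) (gridpt N i.+1).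
  by rewrite /spectral_inc subrr dotL20l mulr0.
apply/eqP; rewrite eq_le H/=.
have [ij|] := ltnP i j.
  by rewrite ge_min !le_max (gridpt_le _ ij) !orbT.
rewrite leq_eqVlt val_eqE (negbTE ji)/= => {}ji.
by rewrite ge_min !le_max (gridpt_le _ ji) !orbT.
Qed.

Lemma measurable_cell N i : measurable (grid_cell N i).
Proof. exact: measurable_itv. Qed.

Lemma measurable_stepfun N psi : measurable_fun setT (stepfun N psi).
Proof.
apply: measurable_sum => i; apply: measurable_funM => //.
by apply: measurable_indic; exact: measurable_cell.
Qed.

(** The mass of the intersection of two cells is the increment of (E_a f, f) over it, which is also
    what the product of the two projections gives. *)
Lemma Rintegral_cells N M i j f :
  \int[spectral_measure Sp f]_x (\1_(grid_cell N i) x * \1_(grid_cell M j) x) =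
  dotL2 (spectral_inc (gridpt N i) (gridpt N i.+1) f)
        (spectral_inc (gridpt M j) (gridpt M j.+1) f).
Proof.
rewrite dot_spectral_inc ?gridpt_le//.
have E : grid_cell N i `&` grid_cell M j =
    `](Num.max (gridpt N i) (gridpt M j)), (Num.min (gridpt N i.+1) (gridpt M j.+1))]%classic.
  apply/seteqP; split => x /=; rewrite /grid_cell /= !in_itv/= gt_max le_min.
    by move=> [/andP[-> ->] /andP[-> ->]].
  by move=> /andP[/andP[-> ->] /andP[-> ->]].
under eq_Rintegral => x _ do
  rewrite -[_ * _]/((\1_(grid_cell N i) \* \1_(grid_cell M j)) x) -indicI E.
rewrite /Rintegral integral_indic// setIT.
case: ifPn => [le|].
  rewrite /spectral_inc dotL2Bl -[RHS]/(fine (_)%:E); congr fine.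
  exact: spectral_measure_oc.
by rewrite -ltNge => lt; rewrite set_itv_ge ?measure0// bnd_simp -leNgt ltW.
Qed.

(** The isometry between step functions in L^2 of d(E_a f, f) and their sums. The two grids may
    differ, as a Cauchy estimate requires. *)
Lemma Rintegral_steps N M psi chi f :
  \int[spectral_measure Sp f]_x (stepfun N psi x * stepfun M chi x) =
  dotL2 (stepop N psi f) (stepop M chi f).
Proof.
have mc (k i : nat) : measurable_fun setT (\1_(grid_cell k i) : R -> R).
  by apply: measurable_indic; exact: measurable_cell.
have bc (k i : nat) x : `|\1_(grid_cell k i) x : R| <= 1.
  by rewrite indicE; case: (_ \in _); rewrite ?normr1// normr0.
rewrite dot_stepop.
pose G (i : 'I_(gridsize N)) x := \1_(grid_cell N i) x * stepfun M chi x.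
transitivity (\int[spectral_measure Sp f]_x
   (\sum_(i < gridsize N) psi (gridpt N i) * G i x)).
  by apply: eq_Rintegral => x _; rewrite mulr_suml; apply: eq_bigr => i _; rewrite mulrA.
rewrite (@bounded_Rintegral_sum _ _ _ _ (spectral_measure_fin f) _ _ _
    (\sum_(j < gridsize M) `|chi (gridpt M j)|)); last 2 first.
- move=> i; apply: measurable_funM; [exact: mc|exact: measurable_stepfun].
- move=> i x; rewrite /G normrM (le_trans (ler_piMl _ (bc _ _ _)))//.
  rewrite (le_trans (ler_norm_sum _ _ _))//; apply: ler_sum => j _.
  by rewrite normrM ler_piMr.
apply: eq_bigr => i _; congr (_ * _).
rewrite dotL2C dot_stepop.
transitivity (\int[spectral_measure Sp f]_x
   (\sum_(j < gridsize M) chi (gridpt M j) *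
      (\1_(grid_cell N i) x * \1_(grid_cell M j) x))).
  apply: eq_Rintegral => x _; rewrite /G /stepfun mulr_sumr; apply: eq_bigr => j _.
  by rewrite mulrCA.
rewrite (@bounded_Rintegral_sum _ _ _ _ (spectral_measure_fin f) _ _ _ 1).
- by apply: eq_bigr => j _; rewrite Rintegral_cells dotL2C.
- by move=> j; apply: measurable_funM; exact: mc.
- by move=> j x; rewrite normrM mulr_ile1.
Qed.

Lemma Rintegral_step N psi f :
  \int[spectral_measure Sp f]_x stepfun N psi x = dotL2 (stepop N psi f) f.
Proof.
have mc (k i : nat) : measurable_fun setT (\1_(grid_cell k i) : R -> R).
  by apply: measurable_indic; exact: measurable_cell.
rewrite (@bounded_Rintegral_sum _ _ _ _ (spectral_measure_fin f) _ _ _ 1) => [|i|i x]; last 2 first.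
- exact: mc.
- by rewrite indicE; case: (_ \in _); rewrite ?normr1// normr0.
rewrite dot_stepop; apply: eq_bigr => i _; congr (_ * _).
rewrite /Rintegral integral_indic//; last exact: measurable_cell.
  rewrite setIT /spectral_inc dotL2Bl -[RHS]/(fine (_)%:E); congr fine.
by apply: spectral_measure_oc; exact: gridpt_le.
Qed.

End spectral_steps.

(* Left continuity matches the half-open cells ]a_i, a_{i+1}] sampled at a_i,
   and is kept by truncation to a <= c. *)
Definition bounded_leftcont {R : realType} (psi : R -> R) : Prop :=
  (exists M : R, forall x, `|psi x| <= M) /\
  (forall x, psi y @[y --> x^'-] --> psi x).

Section bounded_leftcont_closure.
Context {R : realType}.
Implicit Types psi chi : R -> R.

Lemma bounded_leftcont_cst (c : R) : bounded_leftcont (fun=> c).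
Proof. by split=> [|x]; [exists `|c| | exact: cvg_cst]. Qed.

Lemma bounded_leftcontM psi chi : bounded_leftcont psi -> bounded_leftcont chi ->
  bounded_leftcont (psi \* chi).
Proof.
move=> [[M pM] cp] [[K cK] cc]; split=> [|x]; last by apply: cvgM.
by exists (M * K) => x /=; rewrite normrM ler_pM.
Qed.

Lemma bounded_leftcontD psi chi : bounded_leftcont psi -> bounded_leftcont chi ->
  bounded_leftcont (psi \+ chi).
Proof.
move=> [[M pM] cp] [[K cK] cc]; split=> [|x]; last by apply: cvgD.
by exists (M + K) => x /=; rewrite (le_trans (ler_normD _ _))// lerD.
Qed.

End bounded_leftcont_closure.

(** * Approximation of left-continuous functions by step functions *)

Section step_approximation.
Context {R : realType}.
Implicit Types (psi : R -> R) (x M : R).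

Lemma stepfunE N i psi x : (i < gridsize N)%N -> grid_cell N i x ->
  stepfun N psi x = psi (gridpt N i).
Proof.
move=> iN xi; rewrite /stepfun (bigD1 (Ordinal iN))//= big1 ?addr0 => [|j ji].
  by rewrite indicE mem_set// mulr1.
rewrite indicE memNset ?mulr0// => xj; move: xi xj.
rewrite /grid_cell/= !in_itv/= => /andP[i1 i2] /andP[j1 j2].
have {}ji : (j != i :> nat) by move: ji; rewrite -val_eqE.
have [ij|] := ltnP i j.
  by have := le_lt_trans (le_trans i2 (gridpt_le N ij)) j1; rewrite ltxx.
rewrite leq_eqVlt (negbTE ji)/= => {}ji.
by have := le_lt_trans (le_trans j2 (gridpt_le N ji)) i1; rewrite ltxx.
Qed.

Lemma stepfun_bound N psi M x : (forall y, `|psi y| <= M) -> `|stepfun N psi x| <= M.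
Proof.
move=> pM; have M0 : 0 <= M by apply: le_trans (pM 0).
have [[i [iN xi]]|nx] := pselect (exists i, (i < gridsize N)%N /\ grid_cell N i x).
  by rewrite (stepfunE _ iN xi).
rewrite /stepfun big1 ?normr0// => i _; rewrite indicE memNset ?mulr0// => xi.
by apply: nx; exists i.
Qed.

Lemma grid_cell_ex N x : `|x| < N%:R ->
  exists i, (i < gridsize N)%N /\ grid_cell N i x.
Proof.
rewrite ltr_norml => /andP[x1 x2].
pose z := (x + N%:R) * N.+1%:R.
have zsz : z <= (gridsize N)%:R.
  rewrite /z /gridsize natrM ler_pM2r ?ltr0Sn// -muln2 natrM mulr_natr mulr2n.
  by rewrite lerD2r ltW.
have zex : exists n, z <= n%:R by exists (gridsize N).
(* In the coordinate [z] the cells are ]i, i+1], closed on the right, so [i.+1] is the least natural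
   number bounding [z]; it is not 0 because x > -N. *)
case: (ex_minnP zex) => -[|i] zi imin.
  move: zi; rewrite /z pmulr_lle0 ?ltr0Sn// -lerBrDr sub0r leNgt.
  by rewrite x1.
exists i; split; first by have := imin _ zsz.
rewrite /grid_cell/= in_itv/= /gridpt ltrBlDr lerBrDr ltr_pdivrMr ?ltr0Sn//.
rewrite ler_pdivlMr ?ltr0Sn// -/z zi andbT ltNge; apply/negP => /imin.
by rewrite ltnn.
Qed.

Lemma stepfun_cvg psi x : bounded_leftcont psi ->
  stepfun N psi x @[N --> \oo] --> psi x.
Proof.
move=> [_ /(_ x) /cvgrPdist_le cx]; apply/cvgrPdist_le => e e0.
have := cx _ e0; rewrite /at_left /within/= => /nbhs_ballP[eta/= eta0 H].
near=> N.
have [|i [iN xi]] := @grid_cell_ex N x; first by near: N; exact: nbhs_infty_gtr.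
rewrite (stepfunE _ iN xi); move: xi; rewrite /grid_cell/= in_itv/= => /andP[x1 x2].
apply: H => //=; rewrite /ball/= ger0_norm ?subr_ge0 ?ltW//.
apply: (@le_lt_trans _ _ (N.+1%:R^-1)).
  rewrite lerBlDr (le_trans x2)// /gridpt -[i.+1%:R]natr1 mulrDl mul1r.
  by rewrite addrA (addrC N.+1%:R^-1).
by near: N; exact: near_infty_natSinv_lt (PosNum eta0).
Unshelve. all: by end_near. Qed.

Lemma bounded_leftcont_measurable psi : bounded_leftcont psi ->
  measurable_fun [set: measurableTypeR R] psi.
Proof.
move=> ap; apply: (@measurable_fun_cvg _ _ _ _ (fun N => stepfun N psi)).
  by move=> N; exact: measurable_stepfun.
by move=> x _; exact: stepfun_cvg.
Qed.

End step_approximation.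

(** * The limit operators and their algebra *)

Section functional_calculus.
Context {R : realType} {d : measure_display} {T : measurableType d}.
Context {m : {measure set T -> \bar R}} (Sp : spectral_family m).
Implicit Types (f g k : L2 m) (psi chi : R -> R).
Local Notation mu := (spectral_measure Sp).

Lemma spectral_integrable psi M f : measurable_fun [set: measurableTypeR R] psi ->
  (forall x, `|psi x| <= M) -> (mu f).-integrable setT (EFin \o psi).
Proof. by move=> mp pM; apply: bounded_integrable mp pM; exact: spectral_measure_fin. Qed.

Lemma dist_stepop N K psi chi f :
  (exists M : R, forall x, `|psi x| <= M) -> (exists M : R, forall x, `|chi x| <= M) ->
  normL2 (stepop Sp N psi f - stepop Sp K chi f) ^+ 2 =
  \int[mu f]_x (stepfun N psi x - stepfun K chi x) ^+ 2.
Proof.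
move=> [M1 H1] [M2 H2].
have I N1 N2 (p1 p2 : R -> R) A B : (forall x, `|p1 x| <= A) -> (forall x, `|p2 x| <= B) ->
    (mu f).-integrable setT (EFin \o (stepfun N1 p1 \* stepfun N2 p2)).
  move=> HA HB; apply: (@spectral_integrable _ (A * B)).
    by apply: measurable_funM; exact: measurable_stepfun.
  by move=> x /=; rewrite normrM ler_pM// stepfun_bound.
rewrite normL2_sqr dotL2Bl !dotL2Br -!Rintegral_steps.
rewrite -!RintegralB//.
- by apply: eq_Rintegral => x _; ring.
- rewrite /comp; under eq_fun do rewrite EFinB.
  by apply: integrableB => //; [exact: (I _ _ _ _ _ _ H1 H1)|exact: (I _ _ _ _ _ _ H1 H2)].
- rewrite /comp; under eq_fun do rewrite EFinB.
  by apply: integrableB => //; [exact: (I _ _ _ _ _ _ H2 H1)|exact: (I _ _ _ _ _ _ H2 H2)].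
- exact: (I _ _ _ _ _ _ H2 H1).
- exact: (I _ _ _ _ _ _ H2 H2).
- exact: (I _ _ _ _ _ _ H1 H1).
- exact: (I _ _ _ _ _ _ H1 H2).
Qed.

Lemma stepop_cvg psi f : bounded_leftcont psi ->
  exists u, cvgL2 (fun N => stepop Sp N psi f) u.
Proof.
move=> ap; have [[M pM] _] := ap; have mp := bounded_leftcont_measurable ap.
have M0 : 0 <= M by apply: le_trans (pM 0).
pose D N x := (stepfun N psi x - psi x) ^+ 2.
have bD N x : `|D N x| <= (M + M) ^+ 2.
  rewrite normrX lerXn2r ?nnegrE ?addr_ge0//.
  by rewrite (le_trans (ler_normB _ _))// lerD// stepfun_bound.
have mD N : measurable_fun [set: measurableTypeR R] (D N).
  by apply: measurable_funX; apply: measurable_funB => //; exact: measurable_stepfun.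
have D0 : \int[mu f]_x D N x @[N --> \oo] --> (0 : R).
  have -> : 0 = \int[mu f]_x (0 : R).
    by rewrite Rintegral_cst// mul0r.
  apply: (bounded_cvg_Rintegral (spectral_measure_fin Sp f) mD bD) => x.
  rewrite (_ : 0 = (psi x - psi x) ^+ 2); last by rewrite subrr expr2 mul0r.
  rewrite expr2; rewrite /D; under eq_fun do rewrite expr2.
  by apply: cvgM; apply: cvgB; try exact: cvg_cst; exact: stepfun_cvg.
apply: L2_complete => e e0.
(* From (a - b)^2 <= 2 (a - psi)^2 + 2 (b - psi)^2: two integrals below e^2 / 4, each doubled, add
   up to e^2. *)
have e4 : 0 < e ^+ 2 / 4 by rewrite divr_gt0// exprn_gt0.
have /cvgrPdist_le /(_ _ e4)[N _ HN] := D0.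
exists N => n p Nn Np; rewrite -(@ler_pXn2r _ 2) ?nnegrE ?normL2_ge0 ?(ltW e0)//.
rewrite dist_stepop; [|by exists M..].
have iD (k : nat) : (mu f).-integrable setT (EFin \o (fun x => 2 * D k x)).
  apply: (@spectral_integrable _ (2 * (M + M) ^+ 2)); first exact: measurable_funM.
  by move=> x; rewrite normrM ger0_norm// ler_pM2l.
apply: (@le_trans _ _ (\int[mu f]_x (2 * D n x + 2 * D p x))).
  apply: le_Rintegral => //.
  - apply: (@spectral_integrable _ ((M + M) ^+ 2)).
      by apply: measurable_funX; apply: measurable_funB; exact: measurable_stepfun.
    move=> x; rewrite normrX lerXn2r ?nnegrE ?addr_ge0//.
    by rewrite (le_trans (ler_normB _ _))// lerD// stepfun_bound.
  - rewrite /comp; under eq_fun do rewrite EFinD.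
    by apply: integrableD => //; exact: iD.
  - move=> x _; rewrite /D; set a := stepfun n psi x; set b := stepfun p psi x.
    rewrite -subr_ge0.
    have -> : 2 * (a - psi x) ^+ 2 + 2 * (b - psi x) ^+ 2 - (a - b) ^+ 2 =
      ((a - psi x) + (b - psi x)) ^+ 2 by ring.
    exact: sqr_ge0.
rewrite RintegralD//; [|exact: iD..].
have iD' (k : nat) : (mu f).-integrable setT (EFin \o D k).
  exact: (@spectral_integrable _ ((M + M) ^+ 2)).
rewrite !RintegralZl//.
have HD (k : nat) : (N <= k)%N -> \int[mu f]_x D k x <= e ^+ 2 / 4.
  by move=> /HN/=; rewrite sub0r normrN; apply: le_trans; exact: ler_norm.
have alg (a b c : R) : a <= c / 4 -> b <= c / 4 -> 2 * a + 2 * b <= c by lra.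
exact: alg (HD n Nn) (HD p Np).
Qed.

(** A limit in L^2 is determined only up to a null set, so a representative is chosen, with default
    0 when the sums diverge. Identities for [fcalc] therefore hold up to [eqL2] or inside an inner
    product. *)
Definition fcalc psi f : L2 m := xget 0 [set u | cvgL2 (fun N => stepop Sp N psi f) u].

Lemma fcalcP psi f : bounded_leftcont psi -> cvgL2 (fun N => stepop Sp N psi f) (fcalc psi f).
Proof. by move=> /(stepop_cvg f)[u uP]; apply: (xgetPex 0 (ex_intro _ u uP)). Qed.

Lemma fcalc_dot_cvg psi f g : bounded_leftcont psi ->
  dotL2 (stepop Sp N psi f) g @[N --> \oo] --> dotL2 (fcalc psi f) g.
Proof. by move=> ap; apply: cvgL2_dot; exact: fcalcP. Qed.

Lemma fcalc_sym psi f g : bounded_leftcont psi ->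
  dotL2 (fcalc psi f) g = dotL2 f (fcalc psi g).
Proof.
move=> ap; have h1 := @fcalc_dot_cvg _ f g ap; have h2 := @fcalc_dot_cvg _ g f ap.
rewrite -(cvg_lim (@Rhausdorff R) h1) (dotL2C f) -(cvg_lim (@Rhausdorff R) h2).
by congr (lim _); under eq_fun do rewrite stepop_sym dotL2C.
Qed.

Lemma fcalc_dot_int psi f : bounded_leftcont psi ->
  dotL2 (fcalc psi f) f = \int[mu f]_x psi x.
Proof.
move=> ap; have h1 := @fcalc_dot_cvg _ f f ap; have [[M pM] _] := ap.
rewrite -(cvg_lim (@Rhausdorff R) h1); apply: (cvg_lim (@Rhausdorff R)).
under eq_fun do rewrite -Rintegral_step.
apply: (bounded_cvg_Rintegral (spectral_measure_fin Sp f) (M := M)).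
- by move=> N; exact: measurable_stepfun.
- by move=> N x; exact: stepfun_bound.
- by move=> x; exact: stepfun_cvg.
Qed.

Lemma dot_fcalc_fcalc psi chi f g : bounded_leftcont psi -> bounded_leftcont chi ->
  dotL2 (fcalc psi f) (fcalc chi g) = dotL2 (fcalc (psi \* chi) f) g.
Proof.
move=> ap ac; have h2 := @fcalc_dot_cvg _ f g (bounded_leftcontM ap ac).
have h1 := cvgL2_dot2 (fcalcP f ap) (fcalcP g ac).
rewrite -(cvg_lim (@Rhausdorff R) h1) -(cvg_lim (@Rhausdorff R) h2).
by congr (lim _); under eq_fun do rewrite stepop_mul.
Qed.

Lemma fcalcM psi chi f : bounded_leftcont psi -> bounded_leftcont chi ->
  eqL2 (fcalc psi (fcalc chi f)) (fcalc (psi \* chi) f).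
Proof.
move=> ap ac; apply/eqL2_dotP => k.
have -> : psi \* chi = chi \* psi by apply/funext => x /=; rewrite mulrC.
by rewrite (fcalc_sym _ _ ap) (dot_fcalc_fcalc _ _ ac ap).
Qed.

Lemma fcalc_linl psi chi a f k : bounded_leftcont psi -> bounded_leftcont chi ->
  dotL2 (fcalc (fun x => a * psi x + chi x) f) k =
  a * dotL2 (fcalc psi f) k + dotL2 (fcalc chi f) k.
Proof.
move=> ap ac; have aa : bounded_leftcont (fun x => a * psi x + chi x).
  exact: bounded_leftcontD (bounded_leftcontM (bounded_leftcont_cst a) ap) ac.
have h := @fcalc_dot_cvg _ f k aa.
have h1 := @fcalc_dot_cvg _ f k ap; have h2 := @fcalc_dot_cvg _ f k ac.
have h3 : a * dotL2 (stepop Sp N psi f) k + dotL2 (stepop Sp N chi f) k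
    @[N --> \oo] --> a * dotL2 (fcalc psi f) k + dotL2 (fcalc chi f) k.
  apply: cvgD; last exact: h2.
  by apply: cvgM; [exact: cvg_cst|exact: h1].
suff E : (fun N => dotL2 (stepop Sp N (fun x => a * psi x + chi x) f) k) =
    (fun N => a * dotL2 (stepop Sp N psi f) k + dotL2 (stepop Sp N chi f) k).
  by rewrite -(cvg_lim (@Rhausdorff R) h) -(cvg_lim (@Rhausdorff R) h3) E.
apply/funext => N.
rewrite !dot_stepop mulr_sumr -big_split/=; apply: eq_bigr => i _; ring.
Qed.

Lemma fcalcZ psi a f k : bounded_leftcont psi ->
  dotL2 (fcalc (fun x => a * psi x) f) k = a * dotL2 (fcalc psi f) k.
Proof.
move=> ap; have -> : (fun x => a * psi x) = (fun x => (a - 1) * psi x + psi x).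
  by apply/funext => x; rewrite mulrBl mul1r subrK.
by rewrite (fcalc_linl _ _ _ ap ap) mulrBl mul1r subrK.
Qed.

(** |psi(-A) f|^2 is the integral of psi^2 against d(E_a f, f), a measure of total mass at most
    |f|^2. *)
Lemma fcalc_norm psi M f : bounded_leftcont psi -> (forall x, `|psi x| <= M) ->
  normL2 (fcalc psi f) <= M * normL2 f.
Proof.
move=> ap pM; have M0 : 0 <= M by apply: le_trans (pM 0).
apply: normL2_le; first by rewrite mulr_ge0 ?normL2_ge0.
have app := bounded_leftcontM ap ap.
rewrite dot_fcalc_fcalc// fcalc_dot_int// exprMn normL2_sqr.
have bM x : `|(psi \* psi) x| <= M ^+ 2 by rewrite normrM expr2 ler_pM.
apply: (@le_trans _ _ (\int[mu f]_x (M ^+ 2))).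
  apply: le_Rintegral => //.
  - exact: (spectral_integrable _ (bounded_leftcont_measurable app) bM).
  - by apply: (@spectral_integrable _ (M ^+ 2)) => // x; rewrite ger0_norm// sqr_ge0.
  - by move=> x _; apply: le_trans (bM x); exact: ler_norm.
rewrite Rintegral_cst// ler_wpM2l ?sqr_ge0// -lee_fin fineK.
  exact: spectral_measure_setT.
by rewrite ge0_fin_numE//; exact: spectral_measure_fin.
Qed.

Lemma fcalc_ae psi f g : bounded_leftcont psi -> eqL2 f g ->
  eqL2 (fcalc psi f) (fcalc psi g).
Proof.
move=> ap fg; apply/eqL2_dotP => k; rewrite !fcalc_sym//.
exact: eq_dotL2l.
Qed.

(** The sum telescopes to E_N f - E_{-N} f, where the second term vanishes as soon as N > 0 and the
    first tends to f. *)
Lemma fcalc1 f : eqL2 (fcalc (fun=> 1) f) f.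
Proof.
apply/eqL2_dotP => k; have h := @fcalc_dot_cvg _ f k (bounded_leftcont_cst 1).
rewrite -(cvg_lim (@Rhausdorff R) h); apply: (cvg_lim (@Rhausdorff R)).
have h1 : cvgL2 (fun N => Sp N%:R f) f.
  exact: (cvg_comp (fun n : nat => n%:R : R) _ (@cvgr_idn R) (spectral_cvg Sp f)).
apply: cvg_trans (cvgL2_dot (k := k) h1); apply: near_eq_cvg.
near=> N; rewrite dot_stepop.
under eq_bigr do rewrite mul1r /spectral_inc dotL2Bl.
rewrite -(big_mkord xpredT (fun i => dotL2 (Sp (gridpt N i.+1) f) k - dotL2 (Sp (gridpt N i) f) k)).
rewrite telescope_sumr// {1}/gridpt /gridsize natrM mulfK ?lt0r_neq0 ?ltr0Sn//.
rewrite -muln2 natrM mulr_natr mulr2n addrK {1}/gridpt mul0r sub0r.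
have N0 : (0 < N)%N by near: N; exact: nbhs_infty_gt.
have neg : eqL2 (Sp (- N%:R) f) 0 by apply: spectral_neg; rewrite oppr_lt0 ltr0n.
by rewrite (eq_dotL2l k neg) dotL20l subr0.
Unshelve. all: by end_near. Qed.

(** Dominated convergence against d(E_a g, g) settles the quadratic forms, and polarization the pair
    (f, k). *)
Lemma fcalc_cvg (psi_ : nat -> R -> R) psi M f k :
  (forall n, bounded_leftcont (psi_ n)) -> bounded_leftcont psi ->
  (forall n x, `|psi_ n x| <= M) -> (forall x, psi_ n x @[n --> \oo] --> psi x) ->
  dotL2 (fcalc (psi_ n) f) k @[n --> \oo] --> dotL2 (fcalc psi f) k.
Proof.
move=> ap_ ap pM pp.
have diag g : dotL2 (fcalc (psi_ n) g) g @[n --> \oo] --> dotL2 (fcalc psi g) g.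
  rewrite fcalc_dot_int//; under eq_fun do rewrite fcalc_dot_int//.
  apply: (bounded_cvg_Rintegral (spectral_measure_fin Sp g) (M := M)) => // n.
  exact: bounded_leftcont_measurable.
have pol chi : bounded_leftcont chi -> dotL2 (fcalc chi f) k =
    4^-1 * (dotL2 (fcalc chi (f + k)) (f + k) - dotL2 (fcalc chi (f - k)) (f - k)).
  by move=> ac; apply: sym_polarization => g h; exact: fcalc_sym.
rewrite pol//; under eq_fun do rewrite pol//.
by apply: cvgM; [exact: cvg_cst|apply: cvgB; exact: diag].
Qed.

End functional_calculus.

(** * Spectral integrals of unbounded functions *)

Section truncation.
Context {R : realType}.
Implicit Types (phi : R -> R) (c M x : R).

(* phi is only given on [0, +oo[; extending it by phi 0 lets the grids cover the
   whole line, the negative part being null for d(E_a f, f). *)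
Definition pospart_comp phi x := phi (Num.max x 0).

Definition truncate phi c x := phi (Num.max x 0) * (x <= c)%R%:R.

Lemma pospart_comp_left phi x : {within `[0, +oo[, continuous phi} ->
  pospart_comp phi y @[y --> x^'-] --> pospart_comp phi x.
Proof.
move=> /continuous_within_itvcyP[cphi _]; rewrite /pospart_comp.
have [x0|x0] := leP x 0.
  apply: cvg_near_cst; near=> y.
  by rewrite max_r// (le_trans _ x0).
apply: (@cvg_trans _ (phi y @[y --> x^'-])).
  apply: near_eq_cvg; near=> y; rewrite max_l//.
  by near: y; exact: nbhs_left_ge.
by apply: cvg_at_left_filter; apply: cphi; rewrite in_itv/= x0.
Unshelve. all: by end_near. Qed.

Lemma bounded_leftcont_pospart phi M : {within `[0, +oo[, continuous phi} ->
  (forall x, 0 <= x -> `|phi x| <= M) -> bounded_leftcont (pospart_comp phi).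
Proof.
move=> cphi bphi; split=> [|x]; last exact: pospart_comp_left.
by exists M => x; apply: bphi; rewrite le_max lexx orbT.
Qed.

Lemma bounded_leftcont_truncate phi c : {within `[0, +oo[, continuous phi} ->
  0 <= c -> bounded_leftcont (truncate phi c).
Proof.
move=> cphi c0; split=> [|x].
  have cc : {within `[0, c], continuous phi}.
    by apply: continuous_subspaceW cphi; exact: subset_itvl.
  have [a _ amax] := EVT_max c0 cc.
  have [b _ bmin] := EVT_min c0 cc.
  exists (`|phi a| + `|phi b|) => x; rewrite /truncate normrM.
  have [xc|xc] := leP x c; last by rewrite normr0 mulr0 addr_ge0.
  rewrite normr1 mulr1.
  have xI : Num.max x 0 \in `[0, c].
    by rewrite in_itv/= le_max lexx orbT ge_max xc c0.
  have := amax _ xI; have := bmin _ xI; have := ler_norm (phi a).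
  have := ler_norm (- phi b); rewrite normrN ler_norml.
  have := normr_ge0 (phi a); have := normr_ge0 (phi b).
  move: (phi (Num.max x 0)) (phi a) (phi b) => p q r; move: `|q| `|r| => q' r'.
  by move=> *; apply/andP; split; lra.
have [xc|xc] := leP x c.
  rewrite {2}/truncate xc mulr1 -[phi (Num.max x 0)]/(pospart_comp phi x).
  apply: (@cvg_trans _ (pospart_comp phi y @[y --> x^'-])); last exact: pospart_comp_left.
  apply: near_eq_cvg; near=> y.
  by rewrite /truncate /pospart_comp (_ : y <= c) ?mulr1// (le_trans _ xc).
rewrite {2}/truncate leNgt xc mulr0.
apply: cvg_near_cst; near=> y.
rewrite /truncate leNgt (_ : c < y) ?mulr0//.
Unshelve. all: by end_near. Qed.

Lemma truncate_id phi c x : x <= c -> truncate phi c x = phi (Num.max x 0).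
Proof. by rewrite /truncate => ->; rewrite mulr1. Qed.

End truncation.

Section spectral_integral_fcalc.
Context {R : realType} {d : measure_display} {T : measurableType d}.
Context {m : {measure set T -> \bar R}} (Sp : spectral_family m).
Implicit Types (f g k : L2 m) (psi chi phi : R -> R).
Local Notation mu := (spectral_measure Sp).

(** The negative half-line is the union of the intervals ]-(n+1), -1/(n+1)], and (E_a f, f) is zero
    at both end points. They stop short of 0, where there may be an atom. *)
Lemma spectral_measure_neg f : {ae mu f, forall x, 0 <= x}.
Proof.
pose F (n : nat) : set R := `](- n.+1%:R), (- n.+1%:R^-1)]%classic.
have F0 n : (mu f).-negligible (F n).
  apply/negligibleP; first exact: measurable_itv.
  have le : - n.+1%:R <= - n.+1%:R^-1 :> R.
    by rewrite lerN2 (@le_trans _ _ 1)// ?ler1n// invf_le1// ler1n.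
  apply: (eq_trans (spectral_measure_oc Sp f le)).
  have neg a : a < 0 -> spectral_cdf Sp f a = 0.
    by move=> a0; rewrite /spectral_cdf (eq_dotL2l f (spectral_neg Sp f a0)) dotL20l.
  by rewrite !neg ?subrr// oppr_lt0 ?invr_gt0 ltr0Sn.
apply: negligibleS (negligible_bigcup F0) => x /= /negP; rewrite -ltNge => x0.
have nx0 : 0 < - x by rewrite oppr_gt0.
pose N := Num.truncn (Num.max (- x) (- x)^-1).
have xN : Num.max (- x) (- x)^-1 < N.+1%:R by exact: truncnS_gt.
move: xN; rewrite gt_max => /andP[xN1 xN2].
exists N => //; rewrite /F/= in_itv/= ltrNl xN1/= lerNr.
by rewrite -[leRHS]invrK lef_pV2 ?posrE ?invr_gt0// ltW.
Qed.

(** The right-hand integral runs over the whole line; [truncate phi c] need not vanish on the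
    negative reals, but these carry no mass. *)
Lemma Rintegral_truncate phi c f : {within `[0, +oo[, continuous phi} -> 0 <= c ->
  \int[mu f]_(a in `[0, c]) phi a = \int[mu f]_a truncate phi c a.
Proof.
move=> cphi c0; have mt := bounded_leftcont_measurable (bounded_leftcont_truncate cphi c0).
rewrite Rintegral_mkcond.
have -> : phi \_ `[0, c] = truncate phi c \* \1_(`[0, +oo[%classic).
  apply/funext => x; rewrite patchE mem_setE in_itv/= /truncate indicE mem_setE in_itv/= andbT.
  by have [x0|x0] := leP 0 x; [case: (x <= c); rewrite ?(mulr0, mulr1)//|rewrite mulr0].
congr fine; apply: ae_eq_integral => //.
- apply/measurable_EFinP; apply: measurable_funM => //.
- exact/measurable_EFinP.
- have [N [mN N0 subN]] := spectral_measure_neg f.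
  exists N; split => // x /= h; apply: subN => /= x0; apply: h => _.
  by rewrite indicE mem_setE in_itv/= x0 mulr1.
Qed.

(** Both sides are polarizations of the same quadratic form, the left one by definition and the
    right one by symmetry of the calculus. *)
Lemma spectral_formE phi c f k : {within `[0, +oo[, continuous phi} -> 0 <= c ->
  spectral_form Sp phi c f k = dotL2 (fcalc Sp (truncate phi c) f) k.
Proof.
move=> cphi c0; have bt := bounded_leftcont_truncate cphi c0.
have e g := etrans (Rintegral_truncate g cphi c0) (esym (fcalc_dot_int Sp g bt)).
apply: (etrans (congr2 (fun a b => 4^-1 * (a - b)) (e (f + k)) (e (f - k)))).
by apply/esym/sym_polarization => g h; exact: (fcalc_sym Sp g h bt).
Qed.

Lemma truncate_fcalc phi chi omega c u f : {within `[0, +oo[, continuous phi} ->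
  bounded_leftcont chi -> eqL2 u (fcalc Sp chi f) -> 0 <= c ->
  (forall x, pospart_comp phi x * chi x = omega x) ->
  eqL2 (fcalc Sp (truncate phi c) u)
       (fcalc Sp (fun x => omega x * (x <= c)%R%:R) f).
Proof.
move=> cphi bc uE c0 oE; have bt := bounded_leftcont_truncate cphi c0.
apply: (eqL2_trans (fcalc_ae Sp bt uE)).
have -> : (fun x => omega x * (x <= c)%R%:R) = truncate phi c \* chi.
  by apply/funext => x /=; rewrite -oE /truncate /pospart_comp mulrAC.
exact: (fcalcM Sp f bt bc).
Qed.

(** The bridge from the bounded calculus to unbounded [phi]: a vector u = chi(-A) f lies in the
    domain once phi chi = omega is bounded. By multiplicativity the truncations of [phi] act on [u]
    as those of [omega] act on [f]; their norms stay below M |f|, so monotone convergence gives the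
    domain, and bounded convergence gives the value. For bounded [phi], [chi] can be 1. *)
Lemma spectral_integral_fcalc phi chi omega u f : {within `[0, +oo[, continuous phi} ->
  bounded_leftcont chi -> bounded_leftcont omega ->
  (forall x, pospart_comp phi x * chi x = omega x) -> eqL2 u (fcalc Sp chi f) ->
  spectral_integral Sp phi u (fcalc Sp omega f).
Proof.
move=> cphi bc bo oE uE; have [[M oM] _] := bo.
have bt (n : nat) := bounded_leftcont_truncate cphi (ler0n R n).
have btc (n : nat) : bounded_leftcont (fun x => omega x * (x <= n%:R)%R%:R).
  have -> : (fun x => omega x * (x <= n%:R)%R%:R) = truncate phi n%:R \* chi.
    by apply/funext => x /=; rewrite -oE /truncate /pospart_comp mulrAC.
  exact: bounded_leftcontM.
have oM' (n : nat) x : `|omega x * (x <= n%:R)%R%:R| <= M.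
  by rewrite normrM; case: (x <= _); rewrite ?normr1 ?mulr1// normr0 mulr0 (le_trans _ (oM 0)).
split.
  pose D : set R := `[0, +oo[%classic.
  have mD : measurable (D : set (measurableTypeR R)) by exact: measurable_itv.
  pose g (n : nat) x := ((truncate phi n%:R x) ^+ 2)%:E.
  have mg n : measurable_fun D (g n).
    apply: measurable_funTS; apply/measurable_EFinP; apply: measurable_funX.
    exact: bounded_leftcont_measurable.
  have g0 n x : D x -> (0 <= g n x)%E by rewrite lee_fin sqr_ge0.
  have ndg x : D x -> nondecreasing_seq (g ^~ x).
    move=> _ p q pq; rewrite /g lee_fin /truncate !exprMn ler_wpM2l ?sqr_ge0//.
    have [xp|xp] := leP x p%:R; last by rewrite expr0n/= sqr_ge0.
    by rewrite (le_trans xp) ?ler_nat.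
  have := @cvg_monotone_convergence _ _ _ (mu u) D mD g mg g0 ndg.
  have -> : (\int[mu u]_(x in D) limn (g ^~ x) =
             \int[mu u]_(a in `[0%R, +oo[) (phi a ^+ 2)%:E)%E.
    apply: eq_integral => x; rewrite inE /D/= in_itv/= andbT => x0.
    apply/cvg_lim => //; apply: cvg_near_cst; near=> n.
    rewrite /g truncate_id ?max_l//.
    by near: n; exact: nbhs_infty_ger.
  move=> cv; rewrite /spectral_dom -(cvg_lim _ cv)//.
  apply: (@le_lt_trans _ _ ((M * normL2 f) ^+ 2)%:E); last by rewrite ltry.
  apply: lime_le; first by apply/cvg_ex; eexists; exact: cv.
  apply: nearW => n.
  have btt := bounded_leftcontM (bt n) (bt n).
  have [[K tK] _] := btt.
  have le1 : (\int[mu u]_(x in D) g n x <= \int[mu u]_x g n x)%E.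
    apply: ge0_subset_integral => //.
      by apply/measurable_EFinP; apply: measurable_funX; exact: bounded_leftcont_measurable.
    by move=> x _; rewrite lee_fin sqr_ge0.
  have e2 : (\int[mu u]_x g n x = (dotL2 (fcalc Sp (truncate phi n%:R) u)
      (fcalc Sp (truncate phi n%:R) u))%:E)%E.
    rewrite (dot_fcalc_fcalc Sp u u (bt n) (bt n)) (fcalc_dot_int Sp u btt) /Rintegral fineK.
      by apply: eq_integral => x _; rewrite /g expr2.
    apply: integrable_fin_num => //.
    exact: (spectral_integrable Sp u (bounded_leftcont_measurable btt) tK).
  apply: (le_trans le1); rewrite e2 lee_fin -normL2_sqr.
  rewrite (eqL2_norm (truncate_fcalc cphi bc uE (ler0n R n) oE)).
  rewrite ler_pXn2r ?nnegrE ?normL2_ge0//; last first.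
    by rewrite mulr_ge0 ?normL2_ge0// (le_trans _ (oM 0)).
  exact: (fcalc_norm Sp f (btc n) (oM' n)).
move=> k.
have E (n : nat) : spectral_form Sp phi n%:R u k =
    dotL2 (fcalc Sp (fun x => omega x * (x <= n%:R)%R%:R) f) k.
  rewrite (spectral_formE _ _ cphi (ler0n R n)).
  apply: eq_dotL2l; exact: (truncate_fcalc cphi bc uE (ler0n R n) oE).
under eq_fun do rewrite E.
apply: (fcalc_cvg (M := M)) => // x.
apply: cvg_near_cst; near=> n.
rewrite (_ : x <= n%:R) ?mulr1//; near: n; exact: nbhs_infty_ger.
Unshelve. all: by end_near. Qed.

Lemma spectral_integral_ae phi u h h' : eqL2 h h' ->
  spectral_integral Sp phi u h -> spectral_integral Sp phi u h'.
Proof. by move=> hh [du uh]; split=> // k; rewrite -(eq_dotL2l k hh). Qed.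

(** Positivity of phi(-A), stated for a difference so that f1 - f2 need not be shown to lie in the
    domain. For each truncation the difference of the two forms is the integral of a nonnegative
    function against the measure of f1 - f2; the inequality passes to the limit. *)
Lemma spectral_integral_monotone phi f1 h1 f2 h2 :
  {within `[0, +oo[, continuous phi} -> (forall x, 0 <= x -> 0 <= phi x) ->
  spectral_integral Sp phi f1 h1 -> spectral_integral Sp phi f2 h2 ->
  0 <= dotL2 (h1 - h2) (f1 - f2).
Proof.
move=> cphi p0 [_ /(_ (f1 - f2)) c1] [_ /(_ (f1 - f2)) c2].
have bt (n : nat) := bounded_leftcont_truncate cphi (ler0n R n).
have cv : spectral_form Sp phi n%:R f1 (f1 - f2) - spectral_form Sp phi n%:R f2 (f1 - f2)
    @[n --> \oo] --> dotL2 h1 (f1 - f2) - dotL2 h2 (f1 - f2).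
  by apply: cvgB; [exact: c1|exact: c2].
rewrite dotL2Bl -(cvg_lim (@Rhausdorff R) cv); apply: limr_ge.
  by apply/cvg_ex; eexists; exact: cv.
apply: nearW => n; rewrite !(spectral_formE _ _ cphi (ler0n R n)).
rewrite (fcalc_sym Sp f1 _ (bt n)) (fcalc_sym Sp f2 _ (bt n)) -dotL2Bl.
rewrite -(fcalc_sym Sp _ _ (bt n)) (fcalc_dot_int Sp _ (bt n)).
apply: Rintegral_ge0 => x _; rewrite /truncate mulr_ge0// p0//.
by rewrite le_max lexx orbT.
Qed.

End spectral_integral_fcalc.

(** * The semigroup as the exponential of its generator *)

Lemma le_of_cvg0 {R : realType} (x c : R) (a : nat -> R) :
  (forall n, x <= a n + c) -> a n @[n --> \oo] --> (0 : R) -> x <= c.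
Proof.
move=> xa a0; have cv : a n + c @[n --> \oo] --> 0 + c.
  by apply: cvgD; [exact: a0|exact: cvg_cst].
rewrite -(add0r c) -(cvg_lim (@Rhausdorff R) cv); apply: limr_ge.
  by apply/cvg_ex; eexists; exact: cv.
exact: nearW.
Qed.

Lemma cvg_div_natS {R : realType} (c : R) : c / n.+1%:R @[n --> \oo] --> (0 : R).
Proof. by rewrite -(mulr0 c); apply: cvgM; [exact: cvg_cst|exact: cvg_harmonic]. Qed.

(** The upper bound comes from e^{-y} <= 1/(1 + y) <= 1 - y + y^2, since (1 - y + y^2)(1 + y) = 1 +
    y^3; the lower one from 1 - y <= e^{-y}. *)
Lemma expR_taylor2 {R : realType} (y : R) : 0 <= y ->
  `|expR (- y) - 1 + y| <= y ^+ 2.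
Proof.
move=> y0; have h1 := expR_ge1Dx (- y).
have h2 : expR (- y) <= 1 - y + y ^+ 2.
  rewrite expRN; apply: (@le_trans _ _ ((1 + y)^-1)).
    by rewrite lef_pV2 ?posrE ?expR_gt0 ?expR_ge1Dx//; lra.
  rewrite -[leRHS]mul1r -[leLHS]mul1r ler_pdivrMr ?mul1r; last lra.
  have -> : (1 - y + y ^+ 2) * (1 + y) = 1 + y ^+ 3 by ring.
  by rewrite lerDl exprn_ge0.
by rewrite ger0_norm; lra.
Qed.

Lemma normL2_telescope {R : realType} {d : measure_display} {T : measurableType d}
    {m : {measure set T -> \bar R}} (Z : nat -> L2 m) N (c : R) :
  (forall k, (k < N)%N -> normL2 (Z k.+1 - Z k) <= c) ->
  normL2 (Z N - Z 0%N) <= N%:R * c.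
Proof.
move=> Zc; rewrite -telescope_sumr// (le_trans (normL2_sum _ _))//.
rewrite big_nat_cond; apply: (@le_trans _ _ (\sum_(0 <= i < N | (0 <= i < N)%N && true) c)).
  by apply: ler_sum => i /andP[/andP[_ iN] _]; exact: Zc.
by rewrite -big_nat_cond sumr_const_nat subn0 mulr_natl.
Qed.

(** Meant for a = P_{s+e} v, b = P_s v and c = P_s w: the growth of P_s v - v - s w over one step
    splits into a one-step remainder transported by P_s and e (P_s w - w). *)
Lemma taylor_step_identity {R : realType} {V : lmodType R} (a b c v w : V) (s e : R) :
  a - v - (s + e) *: w - (b - v - s *: w) = (a - (b + e *: c)) + e *: (c - w).
Proof.
rewrite scalerDl scalerBr; move: (s *: w) (e *: w) (e *: c) => x y z.
have -> : a - (b + z) + (z - y) = a - b - y.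
  by rewrite (opprD b z) (addrA a) (addrA (a - b - z)) subrK.
have -> : a - v - (x + y) = a - y - (v + x).
  by rewrite -!addrA -!opprD; congr (a - _); rewrite addrA addrC.
have -> : b - v - x = b - (v + x) by rewrite opprD addrA.
by rewrite opprB addrA subrK addrAC.
Qed.

(** * Taylor estimates for the semigroup *)

Section contraction_semigroup.
Context {R : realType} {d : measure_display} {T : measurableType d}.
Context {m : {measure set T -> \bar R}} (P : R -> L2 m -> L2 m).
Hypothesis sP : symmetric_submarkov_semigroup P.
Implicit Types (f g v w : L2 m) (s t h : R).

Lemma dot_semigroup_lin t a f g k : 0 <= t ->
  dotL2 (P t (a *: f + g)) k = a * dotL2 (P t f) k + dotL2 (P t g) k.
Proof.
move=> t0; rewrite (eq_dotL2l k (linearL2P (semigroup_linear sP t0) a f g)).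
by rewrite dotL2Dl dotL2Zl.
Qed.

Lemma semigroupB t f g : 0 <= t -> eqL2 (P t (f - g)) (P t f - P t g).
Proof.
move=> t0; apply/eqL2_dotP => k.
by rewrite -(scaleN1r g) addrC dot_semigroup_lin// (dotL2Bl (P t f)) mulN1r addrC.
Qed.

Lemma semigroup_lip t f g : 0 <= t -> normL2 (P t f - P t g) <= normL2 (f - g).
Proof.
move=> t0; rewrite -(eqL2_norm (semigroupB f g t0)).
exact: semigroup_contraction.
Qed.

Lemma semigroup_lipD s h v w : 0 <= s -> 0 <= h ->
  normL2 (P (s + h) v - P s w) <= normL2 (P h v - w).
Proof.
move=> s0 h0; apply: le_trans (semigroup_lip (P h v) w s0).
have /eqL2_normP e := semigroupD sP v s0 h0.
by rewrite (le_trans (normL2_trans (P s (P h v)) _ _))// e add0r.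
Qed.

(** One step of length h/(n+1) leaves o(1/n), so n+1 steps together leave o(1). Such a subdivision
    stands in for integrating the derivative of P_s v in s. *)
Lemma generator_remainder_cvg0 h v w : 0 < h -> generator P v w ->
  n.+1%:R * normL2 (P (h / n.+1%:R) v - v - (h / n.+1%:R) *: w)
    @[n --> \oo] --> (0 : R).
Proof.
move=> h0 gw.
have dh0 n : 0 < h / n.+1%:R :> R by rewrite divr_gt0.
have E n : n.+1%:R * normL2 (P (h / n.+1%:R) v - v - (h / n.+1%:R) *: w) =
    h * normL2 ((h / n.+1%:R)^-1 *: (P (h / n.+1%:R) v - v) - w).
  have -> : P (h / n.+1%:R) v - v - (h / n.+1%:R) *: w =
    (h / n.+1%:R) *: ((h / n.+1%:R)^-1 *: (P (h / n.+1%:R) v - v) - w).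
    by rewrite scalerBr scalerA divff ?scale1r// gt_eqF.
  rewrite normL2Z ger0_norm ?(ltW (dh0 n))// mulrA; congr (_ * _).
  by rewrite mulrCA divff ?mulr1// pnatr_eq0.
under eq_fun do rewrite E.
rewrite -(mulr0 h); apply: cvgM; first exact: cvg_cst.
by move/cvg_at_rightP : gw => /(_ (fun n => h / n.+1%:R)); apply; split => //; exact: cvg_div_natS.
Qed.

Lemma semigroup_telescope (e c : R) n (Z : R -> L2 m) :
  (forall k, (k < n)%N -> normL2 (Z (k%:R * e + e) - Z (k%:R * e)) <= c) ->
  normL2 (Z (n%:R * e) - Z 0) <= n%:R * c.
Proof.
move=> Zc; have := @normL2_telescope _ _ _ _ (fun k => Z (k%:R * e)) n c.
rewrite mul0r; apply => k kn.
by rewrite -[k.+1%:R]natr1 mulrDl mul1r; exact: Zc.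
Qed.

(** Discrete form of P_h v - v = int_0^h P_s A v ds: by contraction every step costs at most the
    first one, which is e |w| up to the remainder. *)
Lemma semigroup_increment h v w : 0 <= h -> generator P v w ->
  normL2 (P h v - v) <= h * normL2 w.
Proof.
rewrite le_eqVlt => /predU1P[<- _|h0 gw].
  have /eqL2_normP -> := semigroup0 sP v.
  by rewrite mul0r.
apply: le_of_cvg0 (generator_remainder_cvg0 h0 gw) => n.
have : 0 <= h / n.+1%:R by rewrite divr_ge0// ltW.
have : n.+1%:R * (h / n.+1%:R) = h by rewrite mulrC divfK ?pnatr_eq0.
move: (h / n.+1%:R) => e he e0.
have := @semigroup_telescope e (normL2 (P e v - v)) n.+1 (fun s => P s v).
rewrite he => H.
have {}H : normL2 (P h v - v) <= n.+1%:R * normL2 (P e v - v).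
  apply: le_trans (H _) => [|k kn].
    rewrite (le_trans (normL2_trans (P 0 v) _ _))// gerDl.
    by have /eqL2_normP -> := semigroup0 sP v.
  by apply: semigroup_lipD => //; rewrite mulr_ge0.
have -> : h * normL2 w = n.+1%:R * (e * normL2 w) by rewrite mulrA he.
apply: (le_trans H); rewrite -mulrDr ler_pM2l ?ltr0Sn//.
rewrite (le_trans (normL2_trans (e *: w + v) _ _))//.
rewrite addrK normL2Z ger0_norm// opprD addrA lerD2r.
by rewrite (_ : P e v - e *: w - v = P e v - v - e *: w)// addrAC.
Qed.

(** Discrete form of P_h v - v - h A v = int_0^h (P_s A v - A v) ds, where the integrand is at most
    s |A^2 v| <= h |A^2 v| by [semigroup_increment]. *)
Lemma semigroup_taylor2 h v w z : 0 <= h -> generator P v w -> generator P w z ->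
  normL2 (P h v - v - h *: w) <= h ^+ 2 * normL2 z.
Proof.
rewrite le_eqVlt => /predU1P[<- _ _|h0 gw gz].
  have /eqL2_normP H := semigroup0 sP v.
  by rewrite scale0r subr0 H expr0n/= mul0r.
apply: le_of_cvg0 (generator_remainder_cvg0 h0 gw) => n.
have : 0 <= h / n.+1%:R by rewrite divr_ge0// ltW.
have : n.+1%:R * (h / n.+1%:R) = h by rewrite mulrC divfK ?pnatr_eq0.
move: (h / n.+1%:R) => e he e0.
have := @semigroup_telescope e (normL2 (P e v - v - e *: w) + e * (h * normL2 z))
  n.+1 (fun s => P s v - v - s *: w).
rewrite he => H.
have {}H : normL2 (P h v - v - h *: w) <=
    n.+1%:R * (normL2 (P e v - v - e *: w) + e * (h * normL2 z)).
  apply: le_trans (H _) => [|k kn].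
    have z0 : normL2 (P 0 v - v - 0 *: w) = 0.
      by rewrite scale0r subr0; apply/eqL2_normP; exact: semigroup0.
    have := normL2D (P h v - v - h *: w - (P 0 v - v - 0 *: w)) (P 0 v - v - 0 *: w).
    by rewrite subrK z0 addr0.
  have s0 : 0 <= k%:R * e by rewrite mulr_ge0.
  have sh : k%:R * e <= h.
    by rewrite -he ler_wpM2r// ler_nat ltnW.
  move: (k%:R * e) s0 sh => s s0 sh.
  rewrite (taylor_step_identity _ _ (P s w)).
  rewrite (le_trans (normL2D _ _))// lerD//.
    have E : eqL2 (P s v + e *: P s w) (P s (e *: w + v)).
      by apply/eqL2_dotP => k'; rewrite dot_semigroup_lin// dotL2Dl dotL2Zl addrC.
    have /eqL2_normP e1 := E.
    rewrite (le_trans (normL2_trans (P s (e *: w + v)) _ _))//.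
    rewrite (normL2B (P s (e *: w + v))) e1 addr0.
    rewrite (le_trans (semigroup_lipD _ _ s0 e0))//.
    by rewrite opprD addrA addrAC.
  rewrite normL2Z ger0_norm// ler_wpM2l//.
  rewrite (le_trans (semigroup_increment s0 gz))//.
  by rewrite ler_wpM2r ?normL2_ge0.
by apply: (le_trans H); rewrite mulrDr lerD2l mulrA he expr2 mulrA.
Qed.

(** * Identification of the semigroup on bounded spectral subspaces *)

Section semigroup_spectral.
Variable Sp : spectral_family m.
Hypothesis gS : spectral_family_of_generator P Sp.

Lemma continuous_within (phi : R -> R) : continuous phi ->
  {within `[0, +oo[, continuous phi}.
Proof. by move=> c; apply: continuous_subspaceT. Qed.

Lemma generator_fcalc chi omega f : bounded_leftcont chi -> bounded_leftcont omega ->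
  (forall x, - Num.max x 0 * chi x = omega x) ->
  generator P (fcalc Sp chi f) (fcalc Sp omega f).
Proof.
move=> bc bo oE; apply/gS.
have bo' : bounded_leftcont (fun x => -1 * omega x).
  exact: bounded_leftcontM (bounded_leftcont_cst _) bo.
have oE' x : pospart_comp id x * chi x = -1 * omega x.
  by rewrite -oE /pospart_comp /=; ring.
have cid : {within `[0, +oo[, continuous (@id R)}.
  by apply: continuous_within => x; exact: cvg_id.
apply: spectral_integral_ae (spectral_integral_fcalc cid bc bo' oE' (eqL2_refl _)).
apply/eqL2_dotP => k.
by rewrite (fcalcZ Sp _ _ _ bo) mulN1r dotL2Nl.
Qed.

(** The symbol of A^k e^{rA} on the spectral subspace a <= c, where A is bounded; the sign is that
    of A = - int a dE_a. *)
Definition exp_trunc (k : nat) (r c : R) : R -> R :=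
  truncate (fun a => (- a) ^+ k * expR (- r * a)) c.

Lemma exp_trunc_blc k r (n : nat) : bounded_leftcont (exp_trunc k r n%:R).
Proof.
apply: bounded_leftcont_truncate => //; apply: continuous_within => x.
apply: cvgM.
  apply: (continuous_comp (g := fun y : R => y ^+ k)).
    exact: opp_continuous.
  exact: exprn_continuous.
by apply: continuous_comp; [exact: mulrl_continuous|exact: continuous_expR].
Qed.

Lemma exp_truncS k r c x : - Num.max x 0 * exp_trunc k r c x = exp_trunc k.+1 r c x.
Proof. by rewrite /exp_trunc /truncate exprS !mulrA. Qed.

Lemma exp_trunc_bound k r (n : nat) x : 0 <= r -> `|exp_trunc k r n%:R x| <= n%:R ^+ k.
Proof.
move=> r0; rewrite /exp_trunc /truncate normrM.
have [xn|xn] := leP x n%:R; last by rewrite normr0 mulr0 exprn_ge0.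
rewrite normr1 mulr1 normrM (ger0_norm (expR_ge0 _)) normrX normrN.
set y := Num.max x 0; have y0 : 0 <= y by rewrite le_max lexx orbT.
rewrite -[leRHS]mulr1 ler_pM ?expR_ge0//.
  rewrite (ger0_norm y0) lerXn2r ?nnegrE//.
  by rewrite ge_max xn ler0n.
by rewrite -expR0 ler_expR mulNr oppr_le0 mulr_ge0.
Qed.

(** The symbol of (1 + hA) e^{rA} - e^{(r+h)A} cut off at n, written in the shape expected by
    [fcalc_linl]. It factors as -e^{-ra} (e^{-ha} - 1 + ha). *)
Lemma exp_trunc_local r h (n : nat) x : 0 <= r -> 0 <= h ->
  `|h * exp_trunc 1 r n%:R x + (-1 * exp_trunc 0 (r + h) n%:R x + exp_trunc 0 r n%:R x)|
    <= h ^+ 2 * n%:R ^+ 2.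
Proof.
move=> r0 h0; rewrite /exp_trunc /truncate.
have [xn|xn] := leP x n%:R; last by rewrite !mulr0 !addr0 normr0 mulr_ge0 ?exprn_ge0.
set y := Num.max x 0; have y0 : 0 <= y by rewrite le_max lexx orbT.
have yn : y <= n%:R by rewrite ge_max xn ler0n.
have -> : - (r + h) * y = - r * y + - (h * y) by ring.
rewrite expRD.
have -> : h * ((- y) ^+ 1 * expR (- r * y) * true%:R) +
    (-1 * ((- y) ^+ 0 * (expR (- r * y) * expR (- (h * y))) * true%:R) +
     (- y) ^+ 0 * expR (- r * y) * true%:R) =
    - (expR (- r * y) * (expR (- (h * y)) - 1 + h * y)).
  by rewrite expr1 expr0 mulr1n; ring.
rewrite normrN normrM (ger0_norm (expR_ge0 _)) -[leRHS]mul1r ler_pM ?expR_ge0//.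
  by rewrite -expR0 ler_expR mulNr oppr_le0 mulr_ge0.
apply: (le_trans (expR_taylor2 (mulr_ge0 h0 y0))).
by rewrite exprMn ler_wpM2l ?sqr_ge0// lerXn2r ?nnegrE.
Qed.

Definition exp_calc r (n : nat) f := fcalc Sp (exp_trunc 0 r n%:R) f.

(** P_h and e^{hA} are both compared with 1 + hA on the truncated vector; each error is at most h^2
    n^2 |f|, whence the factor 2. *)
Lemma semigroup_local r h (n : nat) f : 0 <= r -> 0 <= h ->
  normL2 (P h (exp_calc r n f) - exp_calc (r + h) n f) <=
  2 * (h ^+ 2 * (n%:R ^+ 2 * normL2 f)).
Proof.
move=> r0 h0; rewrite /exp_calc.
have g1 := generator_fcalc f (exp_trunc_blc 0 r n) (exp_trunc_blc 1 r n) (exp_truncS 0 r n%:R).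
have g2 := generator_fcalc f (exp_trunc_blc 1 r n) (exp_trunc_blc 2 r n) (exp_truncS 1 r n%:R).
have b1 := semigroup_taylor2 h0 g1 g2.
have nw2 := fcalc_norm Sp f (exp_trunc_blc 2 r n) (fun x => exp_trunc_bound 2 n x r0).
pose rho1 x := -1 * exp_trunc 0 (r + h) n%:R x + exp_trunc 0 r n%:R x.
pose rho x := h * exp_trunc 1 r n%:R x + rho1 x.
have br1 : bounded_leftcont rho1.
  apply: bounded_leftcontD (exp_trunc_blc 0 r n).
  exact: bounded_leftcontM (bounded_leftcont_cst (-1)) (exp_trunc_blc 0 (r + h) n).
have br : bounded_leftcont rho.
  apply: bounded_leftcontD br1.
  exact: bounded_leftcontM (bounded_leftcont_cst h) (exp_trunc_blc 1 r n).
have nrho := fcalc_norm Sp f br (fun x => exp_trunc_local n x r0 h0).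
have rhoE k : dotL2 (fcalc Sp rho f) k = h * dotL2 (fcalc Sp (exp_trunc 1 r n%:R) f) k +
  (-1 * dotL2 (fcalc Sp (exp_trunc 0 (r + h) n%:R) f) k +
   dotL2 (fcalc Sp (exp_trunc 0 r n%:R) f) k).
  rewrite (fcalc_linl Sp h f k (exp_trunc_blc 1 r n) br1).
  by rewrite (fcalc_linl Sp (-1) f k (exp_trunc_blc 0 (r + h) n) (exp_trunc_blc 0 r n)).
move: (fcalc Sp rho f) (fcalc Sp (exp_trunc 0 (r + h) n%:R) f)
  (fcalc Sp (exp_trunc 0 r n%:R) f) (fcalc Sp (exp_trunc 1 r n%:R) f)
  (fcalc Sp (exp_trunc 2 r n%:R) f) nrho rhoE nw2 b1.
move=> z vrh vr w1 w2 nz zE nw2 b1.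
have E : eqL2 (h *: w1 + (-1 *: vrh + vr)) z.
  by apply/eqL2_dotP => k; rewrite zE !dotL2Dl !dotL2Zl.
have dbl (q : R) : 2 * q = q + q by ring.
rewrite dbl; have -> : P h vr - vrh = (P h vr - vr - h *: w1) + (h *: w1 + (-1 *: vrh + vr)).
  by rewrite scaleN1r (addrA _ (h *: w1)) subrK (addrC (- vrh)) addrA subrK.
rewrite (le_trans (normL2D _ _))// lerD//.
  by rewrite (le_trans b1)// ler_wpM2l ?sqr_ge0.
by rewrite (eqL2_norm E) mulrA.
Qed.

Lemma semigroup_truncated t (n : nat) f : 0 <= t ->
  eqL2 (P t (exp_calc 0 n f)) (exp_calc t n f).
Proof.
move=> t0; apply/eqL2_normP/eqP; rewrite eq_le normL2_ge0 andbT.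
pose C := 2 * (n%:R ^+ 2 * normL2 f) * t ^+ 2.
apply: le_of_cvg0 (cvg_div_natS C) => N; rewrite addr0.
have : 0 <= t / N.+1%:R by rewrite divr_ge0.
have : N.+1%:R * (t / N.+1%:R) = t by rewrite mulrC divfK ?pnatr_eq0.
have -> : C / N.+1%:R = N.+1%:R * (2 * ((t / N.+1%:R) ^+ 2 * (n%:R ^+ 2 * normL2 f))).
  by rewrite /C; field; rewrite addrC natr1 pnatr_eq0.
move: (t / N.+1%:R) => e he e0.
(* The path s -> P_{t-s} e^{sA} joins P_t to e^{tA}. Over one step both ends share the contraction
   P_{t-(s+e)}, which leaves the local error; N+1 errors of order 1/(N+1)^2 add up to
   [C / N.+1%:R]. *)
have := @semigroup_telescope e (2 * (e ^+ 2 * (n%:R ^+ 2 * normL2 f))) N.+1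
  (fun s => P (t - s) (exp_calc s n f)).
rewrite he (subrr t) (subr0 t) => H.
have e1 : normL2 (P 0 (exp_calc t n f) - exp_calc t n f) = 0.
  by apply/eqL2_normP; exact: semigroup0.
rewrite (le_trans (normL2_trans (P 0 (exp_calc t n f)) _ _))// e1 addr0 normL2B.
apply: H => k kN.
have s0 : 0 <= k%:R * e by rewrite mulr_ge0.
have sh : k%:R * e + e <= t.
  by rewrite -he -[X in _ + X]mul1r -mulrDl natr1 ler_wpM2r// ler_nat.
move: (k%:R * e) s0 sh => s s0 sh.
have u0 : 0 <= t - (s + e) by rewrite subr_ge0.
rewrite normL2B (_ : t - s = t - (s + e) + e); last by ring.
rewrite (le_trans (semigroup_lipD _ _ u0 e0))//.
exact: semigroup_local.
Qed.

Lemma semigroup_fcalc t f : 0 <= t ->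
  eqL2 (P t f) (fcalc Sp (pospart_comp (fun a => expR (- a * t))) f).
Proof.
move=> t0; apply/eqL2_dotP => k.
have cE r : {within `[0, +oo[, continuous (fun a => expR (- r * a) : R)}.
  apply: continuous_within => x.
  by apply: continuous_comp; [exact: mulrl_continuous|exact: continuous_expR].
have lim r g : 0 <= r -> dotL2 (exp_calc r n f) g @[n --> \oo] -->
    dotL2 (fcalc Sp (pospart_comp (fun a => expR (- r * a))) f) g.
  move=> r0; apply: (fcalc_cvg (M := 1)).
  - by move=> n; exact: exp_trunc_blc.
  - apply: (@bounded_leftcont_pospart _ _ 1) => // x x0.
    by rewrite ger0_norm ?expR_ge0// -expR0 ler_expR mulNr oppr_le0 mulr_ge0.
  - by move=> n x; apply: le_trans (exp_trunc_bound 0 n x r0) _; rewrite expr0.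
  - move=> x; apply: cvg_near_cst; near=> n.
    rewrite /exp_trunc truncate_id ?expr0 ?mul1r//; near: n; exact: nbhs_infty_ger.
have l1 := lim t k t0; have l2 := lim 0 (P t k) (lexx 0).
(* Moving P_t onto [k] lets n tend to infinity under the weak convergence of the truncations
   alone. *)
have E : (fun n => dotL2 (exp_calc 0 n f) (P t k)) = (fun n => dotL2 (exp_calc t n f) k).
  apply/funext => n; rewrite -(semigroup_symmetric sP)//.
  exact/eq_dotL2l/semigroup_truncated.
have -> : pospart_comp (fun a => expR (- a * t)) = pospart_comp (fun a => expR (- t * a)).
  by apply/funext => x; rewrite /pospart_comp mulNr mulrC mulNr.
rewrite -(cvg_lim (@Rhausdorff R) l1) -E (cvg_lim (@Rhausdorff R) l2).
have -> : pospart_comp (fun a => expR (- 0 * a)) = (fun=> 1) :> (R -> R).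
  by apply/funext => x; rewrite /pospart_comp oppr0 mul0r expR0.
by rewrite (eq_dotL2l _ (fcalc1 Sp f)) (semigroup_symmetric sP).
Unshelve. all: by end_near. Qed.

End semigroup_spectral.

End contraction_semigroup.

(** * Solving the equation *)

Section symmetric_semigroup_injective.
Context {R : realType} {d : measure_display} {T : measurableType d}.
Context {m : {measure set T -> \bar R}} (P : R -> L2 m -> L2 m).
Hypothesis sP : symmetric_submarkov_semigroup P.

Lemma dot_semigroup_half t f : 0 <= t -> dotL2 (P t f) f = normL2 (P (t / 2) f) ^+ 2.
Proof.
move=> t0; have t20 : 0 <= t / 2 by rewrite divr_ge0.
rewrite normL2_sqr (semigroup_symmetric sP f (P (t / 2) f) t20).
rewrite (dotL2C f (P _ _)) -(eq_dotL2l f (semigroupD sP f t20 t20)).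
by rewrite -splitr.
Qed.

(** If P_t f = 0 then |P_{t/2} f|^2 = (P_t f, f) = 0. Halving repeatedly, P_s f = 0 along times s
    tending to 0, and strong continuity gives f = 0. *)
Lemma semigroup_inj t f : 0 < t -> normL2 (P t f) = 0 -> eqL2 f 0.
Proof.
move=> t0 Pf0; have tn n : 0 < t * 2^-1 ^+ n by rewrite mulr_gt0// exprn_gt0// invr_gt0.
have half n : normL2 (P (t * 2^-1 ^+ n) f) = 0.
  elim: n => [|n IH]; first by rewrite expr0 mulr1.
  apply/eqP; rewrite -sqrf_eq0 (exprSr 2^-1 n) mulrA -dot_semigroup_half ?(ltW (tn n))//.
  by rewrite -normr_le0 (le_trans (cauchy_schwarzL2 _ _))// IH mul0r.
apply/eqL2_normP/eqP; rewrite subr0 eq_le normL2_ge0 andbT.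
have cv : t * 2^-1 ^+ n @[n --> \oo] --> (0 : R).
  rewrite -(mulr0 t); apply: cvgM; first exact: cvg_cst.
  by apply: cvg_expr; rewrite ger0_norm ?invr_ge0// invf_lt1// ltr1n.
have /cvg_at_rightP/(_ _ (conj tn cv)) c0 := semigroup_continuous sP f.
apply: le_of_cvg0 c0 => n; rewrite addr0 normL2B.
have := normL2D (f - P (t * 2^-1 ^+ n) f) (P (t * 2^-1 ^+ n) f).
by rewrite subrK half addr0.
Qed.

End symmetric_semigroup_injective.

(** * Bounds and continuity for the symbol of the equation *)

Section symbol_bounds.
Context {R : realType}.
Implicit Types (phi : R -> R) (t c M : R).

Lemma liminf_gt0_bound phi : (0 < limf_einf (fun a => (phi a)%:E) (pinfty_nbhs R))%E ->
  exists c A, 0 < c /\ forall a, A < a -> c <= phi a.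
Proof.
rewrite limf_einfE => /ereal_sup_gt[_ [V [A [Ar AV]] <-]] V0.
set y := ereal_inf _ in V0.
have yphi a : A < a -> (y <= (phi a)%:E)%E.
  by move=> Aa; apply: ereal_inf_lbound; exists a => //; exact: AV.
(* [y] is an extended real; for the value +oo any positive constant, here 1, lies below it. *)
have [c c0 cy] : exists2 c : R, 0 < c & (c%:E <= y)%E.
  case: {yphi} y V0 => [r||]//; first by exists r.
  by exists 1 => //; rewrite leey.
by exists c, A; split => // a /yphi; rewrite -lee_fin; exact: le_trans.
Qed.

(** Up to [A] the exponential is at least e^{-At}, even where phi vanishes; beyond [A], where the
    exponential decays, phi is at least [c]. *)
Lemma symbol_lower_bound phi t gamma : 0 <= t -> 0 < gamma < 1 ->
  (forall a, 0 <= a -> 0 <= phi a) ->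
  (0 < limf_einf (fun a => (phi a)%:E) (pinfty_nbhs R))%E ->
  exists2 c, 0 < c & forall a, 0 <= a ->
    c <= gamma * phi a + (1 - gamma) * expR (- a * t).
Proof.
move=> t0 /andP[g0 g1] p0 /liminf_gt0_bound[c [A [c0 Ac]]].
have g1' : 0 < 1 - gamma by rewrite subr_gt0.
exists (Num.min (gamma * c) ((1 - gamma) * expR (- A * t))) => [|a a0].
  by rewrite lt_min !mulr_gt0// expR_gt0.
have [aA|Aa] := leP a A.
  rewrite ge_min; apply/orP; right; apply: ler_wpDl; first by rewrite mulr_ge0 ?p0// ltW.
  by rewrite ler_pM2l// ler_expR ler_wpM2r// lerN2.
rewrite ge_min; apply/orP; left; apply: ler_wpDr.
  by rewrite mulr_ge0 ?expR_ge0// ltW.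
by rewrite ler_pM2l// Ac.
Qed.

Lemma within_continuousV (D : R -> R) : {within `[0, +oo[, continuous D} ->
  (forall a, 0 <= a -> D a != 0) -> {within `[0, +oo[, continuous (fun a => (D a)^-1)}.
Proof.
move=> /continuous_within_itvcyP[cD D0] Dn0; apply/continuous_within_itvcyP; split.
  move=> x /[dup] x0 /cD; rewrite in_itv/= andbT in x0.
  by apply: cvgV; rewrite Dn0// ltW.
by apply: cvgV => //; rewrite Dn0.
Qed.

Lemma within_continuousM (D F : R -> R) : {within `[0, +oo[, continuous D} ->
  {within `[0, +oo[, continuous F} -> {within `[0, +oo[, continuous (fun a => D a * F a)}.
Proof. by move=> cD cF x; apply: cvgM; [exact: cD|exact: cF]. Qed.

Lemma within_continuousD (D F : R -> R) : {within `[0, +oo[, continuous D} ->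
  {within `[0, +oo[, continuous F} -> {within `[0, +oo[, continuous (fun a => D a + F a)}.
Proof. by move=> cD cF x; apply: cvgD; [exact: cD|exact: cF]. Qed.

End symbol_bounds.

(** The last hypothesis says that the derivative at [u] in the direction k - u vanishes, so only the
    second-order part remains. Additivity of [A] is required only inside inner products, since P_t
    is additive only almost everywhere. *)
Lemma quadratic_expansion {R : realType} {d : measure_display} {T : measurableType d}
    {m : {measure set T -> \bar R}} (A K : L2 m -> L2 m) (c : R) (g u k : L2 m) :
  (forall f h w, dotL2 (A (f - h)) w = dotL2 (A f) w - dotL2 (A h) w) ->
  (forall f h, dotL2 (K f) h = dotL2 f (K h)) ->
  dotL2 (A u - g) (A (k - u)) + c * dotL2 (K u) (k - u) = 0 ->
  normL2 (A k - g) ^+ 2 + c * dotL2 (K k) k =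
  normL2 (A u - g) ^+ 2 + c * dotL2 (K u) u +
    (normL2 (A (k - u)) ^+ 2 + c * dotL2 (K (k - u)) (k - u)).
Proof.
move=> Al Ks; rewrite !normL2_sqr.
have e1 : dotL2 (A (k - u)) (A (k - u)) =
   dotL2 (A k) (A k) - 2 * dotL2 (A k) (A u) + dotL2 (A u) (A u).
  rewrite Al (dotL2C (A k)) (dotL2C (A u) (A (k - u))) !Al (dotL2C (A u) (A k)).
  by move: (dotL2 _ _) (dotL2 (A k) (A u)) (dotL2 (A u) (A u)) => x y z; ring.
have e2 : dotL2 (K (k - u)) (k - u) = dotL2 (K k) k - 2 * dotL2 (K u) k + dotL2 (K u) u.
  have s1 : dotL2 (K k) u = dotL2 (K u) k by rewrite Ks dotL2C.
  rewrite Ks (dotL2Bl k u) -!Ks (dotL2Br k u (K k)) (dotL2Br k u (K u)) s1.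
  by move: (dotL2 (K k) k) (dotL2 (K u) k) (dotL2 (K u) u) => x y z; ring.
have e3 : dotL2 (A u - g) (A (k - u)) =
   dotL2 (A k) (A u) - dotL2 (A u) (A u) - dotL2 (A k) g + dotL2 (A u) g.
  rewrite dotL2C Al (dotL2Br (A u) g (A k)) (dotL2Br (A u) g (A u)).
  by move: (dotL2 (A k) (A u)) (dotL2 (A u) (A u)) (dotL2 (A k) g) (dotL2 (A u) g) => x y z w; ring.
have e4 f : dotL2 (A f - g) (A f - g) = dotL2 (A f) (A f) - 2 * dotL2 (A f) g + dotL2 g g.
  rewrite dotL2Bl (dotL2Br (A f) g (A f)) (dotL2Br (A f) g g) (dotL2C g (A f)).
  by move: (dotL2 (A f) (A f)) (dotL2 (A f) g) (dotL2 g g) => x y z; ring.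
rewrite e1 e2 e3 !e4 (dotL2Br k u (K u)).
move: (dotL2 (A k) (A k)) (dotL2 (A k) (A u)) (dotL2 (A u) (A u)) (dotL2 (A k) g)
  (dotL2 (A u) g) (dotL2 g g) (dotL2 (K k) k) (dotL2 (K u) k) (dotL2 (K u) u).
move=> x1 x2 x3 x4 x5 x6 x7 x8 x9 H.
apply/eqP; rewrite -subr_eq0; apply/eqP.
(* The two sides differ by exactly twice the first-order term. *)
rewrite -[RHS](mulr0 2) -H; ring.
Qed.

Unset Implicit Arguments.
Set Strict Implicit.
Set Printing Implicit Defensive.

Theorem theorem3p1 (R : realType) (d dO : measure_display)
    (E : metricMeasurableType R d) (m : {measure set E -> \bar R})
    (Omega : measurableType dO)
    (X : R -> Omega -> one_point_compactification E)
    (Pr : one_point_compactification E -> probability Omega R)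
    (P : R -> L2 m -> L2 m) (Sp : spectral_family m)
    (t : R) (phi : R -> R)
    (E_locally_compact : locally_compact [set: E])
    (E_separable : separable_space E)
    (E_borel : @measurable d E = <<s [set U : set E | open U] >>)
    (m_sigma_finite : sigma_finite [set: E] m)
    (m_full_support : full_support m)
    (m_separable : separable_measure m)
    (X_right : borel_right_process X Pr)
    (P_semigroup : symmetric_submarkov_semigroup P)
    (P_extends : extends_transition X Pr P)
    (S_generator : spectral_family_of_generator P Sp)
    (t_gt0 : 0 < t)
    (phi_continuous : {within `[0, +oo[, continuous phi})
    (phi_ge0 : forall a : R, 0 <= a -> 0 <= phi a)
    (phi_liminf : (0 < limf_einf (fun a => (phi a)%:E) (pinfty_nbhs R))%E)
    (phi_sup : (ereal_sup [set (expR (- t * a) * phi a)%:E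
                          | a in `[0%R, +oo[%classic] < +oo)%E) :
  forall (g : L2 m) (gamma : R), 0 < gamma < 1 ->
  exists f : L2 m,
    [/\ solves P Sp t phi gamma g f,
        forall f', solves P Sp t phi gamma g f' -> eqL2 f' f,
        spectral_integral Sp
          (fun a => (gamma * phi a + (1 - gamma) * expR (- a * t))^-1) g f &
        exists2 K : L2 m -> L2 m,
          (forall h,
             spectral_integral Sp (fun a => expR (- a * t) * phi a) h (K h)) &
          unique_argminL2
            (fun h => normL2 (P t h - g) ^+ 2
                      + gamma / (1 - gamma) * dotL2 (K h) h)
            ((1 - gamma) *: f)].
Proof.
move=> g gamma /[dup] g01 /andP[gamma0 gamma1].
have ga1 : 0 < 1 - gamma by rewrite subr_gt0.
have t0 := ltW t_gt0.
have [c c0 Dc] := symbol_lower_bound t0 g01 phi_ge0 phi_liminf.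
have D0 a : 0 <= a -> gamma * phi a + (1 - gamma) * expR (- a * t) != 0.
  by move=> a0; rewrite gt_eqF// (lt_le_trans c0)// Dc.
have [M eM] : exists M, forall a, 0 <= a -> expR (- a * t) * phi a <= M.
  exists (fine (ereal_sup [set (expR (- t * a) * phi a)%:E | a in `[0%R, +oo[%classic])).
  move=> a a0; rewrite -lee_fin fineK; last first.
    rewrite fin_numElt phi_sup andbT (@lt_le_trans _ _ (expR (- t * a) * phi a)%:E)//.
      by rewrite ltNyr.
    by apply: ereal_sup_ubound; exists a => //=; rewrite in_itv/= a0.
  apply: ereal_sup_ubound; exists a => /=; first by rewrite in_itv/= a0.
  have -> : - t * a = - a * t by ring.
  by [].
pose e (a : R) : R := expR (- a * t).
pose Dv a := (gamma * phi a + (1 - gamma) * e a)^-1.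
have ce : {within `[0, +oo[, continuous e}.
  apply: continuous_within => x; rewrite /e.
  apply: continuous_comp; last exact: continuous_expR.
  by apply: cvgM; [exact: opp_continuous|exact: cvg_cst].
have ccst (b : R) : {within `[0, +oo[, continuous (fun _ : R => b)}.
  by apply: continuous_within => x; exact: cvg_cst.
have cDv : {within `[0, +oo[, continuous Dv}.
  apply: within_continuousV D0; apply: within_continuousD.
    exact: within_continuousM (ccst gamma) phi_continuous.
  exact: within_continuousM (ccst (1 - gamma)) ce.
have Dv0 a : 0 <= a -> 0 <= Dv a by move=> a0; rewrite invr_ge0 (le_trans (ltW c0))// Dc.
(* With D the denominator, the symbols 1/D, phi/D, e^{-ta} phi and e^{-ta} are bounded by 1/c,
   1/gamma, M and 1; the second because D >= gamma phi. *)
pose psi := pospart_comp Dv.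
pose om := pospart_comp (fun a => phi a * Dv a).
pose ka := pospart_comp (fun a => e a * phi a).
pose et := pospart_comp e.
have bpsi : bounded_leftcont psi.
  apply: (bounded_leftcont_pospart (M := c^-1) cDv) => a a0.
  rewrite ger0_norm ?Dv0// lef_pV2 ?posrE ?Dc//.
  by rewrite (lt_le_trans c0)// Dc.
have bom : bounded_leftcont om.
  apply: (bounded_leftcont_pospart (M := gamma^-1) (within_continuousM phi_continuous cDv)) => a a0.
  rewrite ger0_norm ?mulr_ge0 ?Dv0 ?phi_ge0//.
  rewrite ler_pdivrMr; last by rewrite (lt_le_trans c0)// Dc.
  rewrite mulrDr mulrA mulVf ?gt_eqF// mul1r lerDl.
  by rewrite !mulr_ge0 ?expR_ge0// ?invr_ge0 ltW.
have bka : bounded_leftcont ka.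
  apply: (bounded_leftcont_pospart (M := M) (within_continuousM ce phi_continuous)) => a a0.
  by rewrite ger0_norm ?mulr_ge0 ?expR_ge0 ?phi_ge0// eM.
have bet : bounded_leftcont et.
  apply: (bounded_leftcont_pospart (M := 1) ce) => a a0.
  by rewrite ger0_norm ?expR_ge0// -expR0 ler_expR mulNr oppr_le0 mulr_ge0.
have b1 : bounded_leftcont (fun=> 1 : R) by exact: bounded_leftcont_cst.
pose f := fcalc Sp psi g; pose h := fcalc Sp om g; pose K := fcalc Sp ka.
have PE k : eqL2 (P t k) (fcalc Sp et k).
  exact: (semigroup_fcalc P_semigroup S_generator k t0).
have sf : spectral_integral Sp phi f h.
  exact: (spectral_integral_fcalc phi_continuous bpsi bom _ (eqL2_refl _)).
have fE : eqL2 ((1 - gamma) *: P t f + gamma *: h) g.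
  apply/eqL2_dotP => k; rewrite (dotL2_lin2 (1 - gamma) gamma (P t f) h k).
  rewrite (eq_dotL2l k (PE f)) (eq_dotL2l k (fcalcM Sp g bet bpsi)).
  have bgo : bounded_leftcont (fun x => gamma * om x).
    exact: bounded_leftcontM (bounded_leftcont_cst gamma) bom.
  rewrite -(fcalcZ Sp gamma g k bom).
  rewrite -(fcalc_linl Sp (1 - gamma) g k (bounded_leftcontM bet bpsi) bgo).
  (* On symbols the equation reads ((1 - gamma) e^{-ta} + gamma phi) / D = 1. *)
  have -> : (fun x => (1 - gamma) * (et \* psi) x + gamma * om x) = (fun=> 1).
    apply/funext => x; rewrite /om /et /psi /pospart_comp /=.
    have x0 : 0 <= Num.max x 0 by rewrite le_max lexx orbT.
    move: (Num.max x 0) x0 => y y0; have := D0 y y0; rewrite /Dv /e.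
    move: (expR _) (phi y) => p q pq.
    by field.
  exact/eq_dotL2l/fcalc1.
have Ksym k1 k2 : dotL2 (K k1) k2 = dotL2 k1 (K k2) by exact: (fcalc_sym Sp k1 k2 bka).
have K0 k : 0 <= dotL2 (K k) k.
  rewrite /K (fcalc_dot_int Sp k bka); apply: Rintegral_ge0 => x _.
  by rewrite /ka /pospart_comp mulr_ge0 ?expR_ge0// phi_ge0// le_max lexx orbT.
exists f; split.
- by exists h.
- move=> f' [h' sf' f'E].
  have mono := spectral_integral_monotone phi_continuous phi_ge0 sf' sf.
  have PB := semigroupB P_semigroup f' f t0.
  have half := dot_semigroup_half P_semigroup (f' - f) t0.
  have z : (1 - gamma) * dotL2 (P t (f' - f)) (f' - f) +
      gamma * dotL2 (h' - h) (f' - f) = 0.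
    have := etrans (esym (dotL2_lin2 (1 - gamma) gamma (P t f') h' (f' - f)))
      (etrans (eq_dotL2l (f' - f) (eqL2_trans f'E (eqL2_sym fE)))
        (dotL2_lin2 (1 - gamma) gamma (P t f) h (f' - f))).
    rewrite (eq_dotL2l (f' - f) PB) (dotL2Bl (P t f') (P t f) (f' - f)).
    rewrite (dotL2Bl h' h (f' - f)); lra.
  have Pd0 : normL2 (P (t / 2) (f' - f)) = 0.
    (* By [z] two nonnegative terms sum to 0, so (P_t (f' - f), f' - f) = 0. *)
    apply/eqP; rewrite -sqrf_eq0 -half eq_le half sqr_ge0 andbT -half.
    rewrite -(pmulr_rle0 _ ga1) -z lerDl.
    by rewrite mulr_ge0// ltW.
  have t20 : 0 < t / 2 by rewrite divr_gt0.
  have := semigroup_inj P_semigroup t20 Pd0.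
  by move=> /eqL2_normP; rewrite subr0 => /eqL2_normP.
- by apply: (spectral_integral_fcalc cDv b1 bpsi _ (eqL2_sym (fcalc1 Sp g))) => x; rewrite mulr1.
exists K => [k|].
  apply: (spectral_integral_fcalc (within_continuousM ce phi_continuous) b1 bka _
    (eqL2_sym (fcalc1 Sp k))) => x.
  by rewrite mulr1.
set u := (1 - gamma) *: f; set cc := gamma / (1 - gamma).
have cc0 : 0 <= cc by apply: divr_ge0; exact: ltW.
have PBd f1 f2 w : dotL2 (P t (f1 - f2)) w = dotL2 (P t f1) w - dotL2 (P t f2) w.
  by rewrite (eq_dotL2l w (semigroupB P_semigroup f1 f2 t0)) dotL2Bl.
(* As u = (1 - gamma) f, the equation gives P_t u - g = -gamma h, while cc K u = gamma K f. Symmetry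
   of P_t and P_t h = P_t phi(-A) f = K f make the terms cancel. *)
have G0 k : dotL2 (P t u - g) (P t (k - u)) + cc * dotL2 (K u) (k - u) = 0.
  move: (k - u) => z.
  have Pu w : dotL2 (P t u) w = (1 - gamma) * dotL2 (P t f) w.
    have := dot_semigroup_lin P_semigroup (1 - gamma) f 0 w t0.
    rewrite addr0 => ->; rewrite (eq_dotL2l w (PE 0)) (fcalc_sym Sp 0 w bet) dotL20l.
    by rewrite addr0.
  have fE' := etrans (esym (dotL2_lin2 (1 - gamma) gamma (P t f) h (P t z)))
    (eq_dotL2l (P t z) fE).
  have etka : et \* om = ka \* psi.
    by apply/funext => x; rewrite /= /et /om /ka /psi /pospart_comp mulrA.
  have hz : dotL2 h (P t z) = dotL2 (K f) z.
    apply: (etrans (esym (semigroup_symmetric P_semigroup h z t0))).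
    apply: (etrans (eq_dotL2l z (PE h))).
    apply: (etrans (eq_dotL2l z (fcalcM Sp g bet bom))); rewrite etka.
    exact: esym (eq_dotL2l z (fcalcM Sp g bka bpsi)).
  have Ku : dotL2 (K u) z = (1 - gamma) * dotL2 (K f) z.
    by rewrite Ksym (dotL2Zl (1 - gamma) f (K z)) -Ksym.
  rewrite (dotL2Bl (P t u) g (P t z)) (Pu (P t z)) Ku -hz -fE' /cc mulrA divfK ?gt_eqF//.
  by ring.
have Jk k := quadratic_expansion PBd Ksym (G0 k).
split=> [k|k]; rewrite (Jk k).
  by rewrite lerDl addr_ge0 ?sqr_ge0// mulr_ge0.
(* A competitor that does no worse than [u] has a nonpositive second-order part, which forces P_t (k
   - u) = 0. *)
rewrite gerDl => le0; have Pz0 : normL2 (P t (k - u)) = 0.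
  apply/eqP; rewrite -sqrf_eq0 eq_le sqr_ge0 andbT (le_trans _ le0)// lerDl.
  by rewrite mulr_ge0.
have := semigroup_inj P_semigroup t_gt0 Pz0.
by move=> /eqL2_normP; rewrite subr0 => /eqL2_normP.
Qed.
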